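(* Let $\Sigma$ be a Riemann surface and let $\phi,\psi:\Sigma\to\mathbf{H}^3_1$ be two conformal spacelike maximal immersions with the same Hopf differentials, $\Theta_\phi=\Theta_\psi$. Then $$\nu_{\{\phi,\psi\}}=(\nu^+_\phi,\nu^-_\psi):\Sigma\to\mathbb{H}^2\times\mathbb{H}^2$$ is a conformal minimal immersion. Moreover, the metric induced on $\Sigma$ by $\nu_{\{\phi,\psi\}}$ is $$g=\frac12\Bigl[(2+|\sigma_\phi|^2)\,g_\phi+(2+|\sigma_\psi|^2)\,g_\psi\Bigr],$$ where $g_\phi$ and $g_\psi$ are the metrics induced on $\Sigma$ by $\phi$ and $\psi$, and $|\sigma_\phi|$, $|\sigma_\psi|$ are the lengths of the second fundamental forms of $\phi$ and $\psi$ in $\mathbf{H}^3_1$, computed with respect to $g_\phi$ and $g_\psi$, respectively.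
   Context: Let $\mathbb{R}^4_2$ be $\mathbb{R}^4$ with its standard orientation and the metric $\langle\!\langle u,v\rangle\!\rangle=u_1v_1+u_2v_2-u_3v_3-u_4v_4$. Anti-De Sitter space is $\mathbf{H}^3_1=\{p\in\mathbb{R}^4_2:\langle\!\langle p,p\rangle\!\rangle=-1\}$ with the induced Lorentzian metric. A spacelike immersion of an oriented surface into $\mathbf{H}^3_1$ is maximal if its mean curvature vanishes; it is conformal if its induced metric is conformal to the complex structure of $\Sigma$ (Riemann surfaces are connected and carry their natural orientation). Given a spacelike conformal maximal immersion $\phi:\Sigma\to\mathbf{H}^3_1$, let $N$ be the unit timelike normal field ($\langle\!\langle N,N\rangle\!\rangle=-1$, $N$ tangent to $\mathbf{H}^3_1$ and orthogonal to $\phi$) such that $\{\phi_x,\phi_y,\phi,N\}$ is a positively oriented frame of $\mathbb{R}^4_2$ for every conformal parameter $z=x+iy$. The Hopf differential of $\phi$ is the (holomorphic) quadratic differential $\Theta_\phi=\langle\!\langle\phi_z,N_z\rangle\!\rangle\,dz\otimes dz$, where $\langle\!\langle\cdot,\cdot\rangle\!\rangle$ is extended complex-bilinearly. The length of the second fundamental form is the nonnegative quantity with $|\sigma_\phi|^2=\sum_{i,j}h(e_i,e_j)^2$, where $\sigma_\phi=hN$ and $\{e_1,e_2\}$ is a $g_\phi$-orthonormal tangent frame (i.e. the sum of squares of the principal curvatures). On $\Lambda^2\mathbb{R}^4_2$ consider the metric $g(v\wedge w,v'\wedge w')=\langle\!\langle v,w'\rangle\!\rangle\langle\!\langle w,v'\rangle\!\rangle-\langle\!\langle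 v,v'\rangle\!\rangle\langle\!\langle w,w'\rangle\!\rangle$ and the star operator defined by $\alpha\wedge(\star\beta)=g(\alpha,\beta)\Omega$, with $\Omega$ the orientation form. Its eigenspaces $\Lambda^2_\pm\mathbb{R}^4_2$ for the eigenvalues $\pm1$ are each isometric to Lorentz–Minkowski 3-space. $\mathbb{H}^2_\pm$ denotes the hyperbolic plane in $\Lambda^2_\pm\mathbb{R}^4_2$ (one sheet of $\{g(\alpha,\alpha)=-1\}$, with the induced metric of curvature $-1$; the two sheets are identified through $\alpha\mapsto-\alpha$), identified with $\mathbb{H}^2$. The components of the Gauss map of $\phi$ are the maps $\nu^\pm_\phi:\Sigma\to\mathbb{H}^2_\pm$, $$\nu^\pm_\phi(p)=\tfrac1{\sqrt2}\bigl[e_1\wedge e_2\pm N(p)\wedge\phi(p)\bigr],$$ where $\{e_1,e_2\}$ is an oriented orthonormal basis of $T_p\Sigma$ (regarded in $\mathbb{R}^4_2$ via $d\phi_p$). $\mathbb{H}^2\times\mathbb{H}^2$ carries the product metric. *)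

(* Defs.v *)
From HB Require Import structures.
From mathcomp Require Import all_boot all_order all_algebra complex ring.
From mathcomp Require Import all_classical all_reals all_analysis.

Set Implicit Arguments.
Unset Strict Implicit.
Unset Printing Implicit Defensive.

Import Order.TTheory GRing.Theory Num.Theory.
Import numFieldNormedType.Exports.

Local Open Scope classical_set_scope.
Local Open Scope complex_scope.
Local Open Scope ring_scope.

(* [R[i]^o] is the field of complex numbers seen as a normed space over
   itself.  [param] is only meaningful on [img]. *)
Record chart (R : realType) (S : topologicalType) := Chart {
  dom : set S;
  img : set R[i]^o;
  coord : S -> R[i]^o;
  param : R[i]^o -> S;
  dom_open : open dom;
  img_open : open img;
  coord_img : forall p, dom p -> img (coord p);
  param_dom : forall z, img z -> dom (param z);
  coordK : forall p, dom p -> param (coord p) = p;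
  paramK : forall z, img z -> coord (param z) = z;
  coord_continuous : forall p, dom p -> {for p, continuous coord};
  param_continuous : forall z, img z -> {for z, continuous param}
}.

(* Derivability over the field [R[i]] is complex differentiability. *)
Definition holomorphic_at (R : realType) (f : R[i]^o -> R[i]^o) (z : R[i]^o) :
  Prop := derivable f z 1.

(* Second countability is not required: it is automatic (Rado).  The atlas need
   not be maximal; all notions below that quantify over its charts are invariant
   under (orientation preserving) holomorphic changes of coordinates. *)
Record riemannSurface (R : realType) := RiemannSurface {
  points :> topologicalType;
  atlas : set (chart R points);
  points_hausdorff : hausdorff_space points;
  points_connected : connected [set: points];
  atlas_cover : forall p : points, exists2 c, atlas c & dom c p;
  atlas_holomorphic : forall c c' : chart R points, atlas c -> atlas c' ->
    forall z, img c z -> dom c' (param c z) ->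
      holomorphic_at (coord c' \o param c) z
}.

(* Local conformal parameters z = x + iy are handled through the real
   coordinates (x, y). *)
Definition conf_dom (R : realType) (S : topologicalType) (c : chart R S) :
  set (R * R) := [set w | img c (w.1 +i* w.2)].

Definition local (R : realType) (S : topologicalType) (c : chart R S)
    (V : Type) (F : S -> V) (w : R * R) : V :=
  F (param c (w.1 +i* w.2)).

Definition dx (R : realType) : R * R := (1, 0).
Definition dy (R : realType) : R * R := (0, 1).
Definition dxy (R : realType) (i : 'I_2) : R * R :=
  if i == 0 then dx R else dy R.

Fixpoint Ck (R : realType) (V : normedModType R) (k : nat) (U : set (R * R))
    (f : R * R -> V) : Prop :=
  match k with
  | 0%N => forall w, U w -> {for w, continuous f}
  | k'.+1 => (forall w, U w -> differentiable f w) /\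
             (forall u, Ck k' U ('D_u f))
  end.

Definition smooth_map (R : realType) (S : riemannSurface R)
    (V : normedModType R) (F : S -> V) : Prop :=
  forall c, atlas c -> forall k, Ck k (conf_dom c) (local c F).

(* The ambient manifold M lies in a vector space V with a symmetric bilinear
   form B; [T q] is the tangent space of M at q.  B is assumed nondegenerate on
   [T q], so that the Levi-Civita connection of M is the component of the
   directional derivative that is tangent to M. *)

Definition first_ff (R : realType) (V : normedModType R) (B : V -> V -> R)
    (f : R * R -> V) (w u v : R * R) : R :=
  B ('D_u f w) ('D_v f w).

(* [xi] is the value at (u, v) of the second fundamental form in M of the
   surface parametrized by f: D_u D_v f is the sum of a vector tangent to the
   surface, of [xi], which is tangent to M and normal to the surface, and of a
   vector normal to M. *)
Definition second_ff (R : realType) (V : normedModType R) (B : V -> V -> R)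
    (T : V -> set V) (f : R * R -> V) (w u v : R * R) (xi : V) : Prop :=
  [/\ T (f w) xi,
      forall a, B xi ('D_a f w) = 0 &
      exists a, forall eta, T (f w) eta ->
        B ('D_u ('D_v f) w - 'D_a f w - xi) eta = 0].

(* H = 1/2 g^{ij} II_{ij} in the coordinates (x, y) *)
Definition mean_curvature (R : realType) (V : normedModType R)
    (B : V -> V -> R) (T : V -> set V) (f : R * R -> V) (w : R * R) (H : V) :
    Prop :=
  let G : 'M[R]_2 := \matrix_(i, j) first_ff B f w (dxy R i) (dxy R j) in
  exists2 II : 'I_2 -> 'I_2 -> V,
    forall i j, second_ff B T f w (dxy R i) (dxy R j) (II i j) &
    H = 2^-1 *: \sum_i \sum_j invmx G i j *: II i j.

Definition immersion (R : realType) (S : riemannSurface R)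
    (V : normedModType R) (F : S -> V) : Prop :=
  smooth_map F /\
  forall c, atlas c -> forall w, conf_dom c w ->
    forall u, u != 0 -> 'D_u (local c F) w != 0.

Definition spacelike (R : realType) (S : riemannSurface R)
    (V : normedModType R) (B : V -> V -> R) (F : S -> V) : Prop :=
  forall c, atlas c -> forall w, conf_dom c w ->
    forall u, u != 0 -> 0 < first_ff B (local c F) w u u.

Definition conformal (R : realType) (S : riemannSurface R)
    (V : normedModType R) (B : V -> V -> R) (F : S -> V) : Prop :=
  forall c, atlas c -> forall w, conf_dom c w ->
    exists2 lambda : R, 0 < lambda &
      forall u v, first_ff B (local c F) w u v =
                  lambda * (u.1 * v.1 + u.2 * v.2).

Definition zero_mean_curvature (R : realType) (S : riemannSurface R)
    (V : normedModType R) (B : V -> V -> R) (T : V -> set V) (F : S -> V) :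
    Prop :=
  forall c, atlas c -> forall w, conf_dom c w ->
    mean_curvature B T (local c F) w 0.

Definition orthonormal_frame (R : realType) (V : normedModType R)
    (B : V -> V -> R) (f : R * R -> V) (w : R * R) (e : 'I_2 -> R * R) : Prop :=
  forall i j, first_ff B f w (e i) (e j) = (i == j)%:R.

Definition oriented (R : realType) (e : 'I_2 -> R * R) : Prop :=
  0 < (e 0).1 * (e 1).2 - (e 0).2 * (e 1).1.

(* Over a general ring, so that it also gives the complex bilinear extension. *)
Definition dot22 (K : pzRingType) (u v : 'rV[K]_4) : K :=
  u 0 0 * v 0 0 + u 0 1 * v 0 1 - u 0 2 * v 0 2 - u 0 3 * v 0 3.

Definition AdS3 (R : realType) : set 'rV[R]_4 := [set p | dot22 p p = -1].

Definition tan_AdS3 (R : realType) (p : 'rV[R]_4) : set 'rV[R]_4 :=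
  [set v | dot22 v p = 0].

Definition conformal_maximal (R : realType) (S : riemannSurface R)
    (phi : S -> 'rV[R]_4) : Prop :=
  (forall p, AdS3 (phi p)) /\
  [/\ immersion phi, spacelike (@dot22 R) phi, conformal (@dot22 R) phi &
      zero_mean_curvature (@dot22 R) (@tan_AdS3 R) phi].

Definition rows4 (R : realType) (a b c d : 'rV[R]_4) : 'M[R]_4 :=
  \matrix_(i, j) [:: a; b; c; d]`_i 0 j.

Definition unit_normal (R : realType) (S : riemannSurface R)
    (phi N : S -> 'rV[R]_4) : Prop :=
  forall c, atlas c -> forall w, conf_dom c w ->
    let f := local c phi in let n := local c N w in
    [/\ dot22 n n = -1, tan_AdS3 (f w) n,
        forall u, dot22 n ('D_u f w) = 0 &
        0 < \det (rows4 ('D_(dx R) f w) ('D_(dy R) f w) (f w) n)].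

(* the Wirtinger derivative f_z = (f_x - i f_y) / 2 *)
Definition wirtinger (R : realType) (f : R * R -> 'rV[R]_4) (w : R * R) :
    'rV[R[i]]_4 :=
  2^-1 *: (map_mx (real_complex R) ('D_(dx R) f w)
           - 'i%C *: map_mx (real_complex R) ('D_(dy R) f w)).

(* the coefficient of dz (x) dz of the Hopf differential in the chart c *)
Definition hopf (R : realType) (S : riemannSurface R) (phi N : S -> 'rV[R]_4)
    (c : chart R S) (w : R * R) : R[i] :=
  dot22 (wirtinger (local c phi) w) (wirtinger (local c N) w).

Definition same_hopf (R : realType) (S : riemannSurface R)
    (phi Nphi psi Npsi : S -> 'rV[R]_4) : Prop :=
  forall c : chart R S, atlas c -> forall w, conf_dom c w ->
    hopf phi Nphi c w = hopf psi Npsi c w.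

(* [s] is the length of the second fundamental form sigma = h N. *)
Definition sff_length (R : realType) (S : riemannSurface R)
    (phi N : S -> 'rV[R]_4) (s : S -> R) : Prop :=
  forall c, atlas c -> forall w, conf_dom c w ->
    let f := local c phi in
    0 <= local c s w /\
    forall e, orthonormal_frame (@dot22 R) f w e ->
      exists2 h : 'I_2 -> 'I_2 -> R,
        forall i j, second_ff (@dot22 R) (@tan_AdS3 R) f w (e i) (e j)
                      (h i j *: local c N w) &
        local c s w ^+ 2 = \sum_i \sum_j h i j ^+ 2.

(* The second exterior power of R^4 is the space of antisymmetric matrices;
   the entry (i, j), i < j, is the coordinate along e_i ^ e_j. *)

Definition bivector (R : realType) : set 'M[R]_4 := [set A | A^T = - A].

Definition wedge (R : realType) (v w : 'rV[R]_4) : 'M[R]_4 :=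
  v^T *m w - w^T *m v.

(* See [biv_metric_wedge]. *)
Definition biv_metric (R : realType) (A B : 'M[R]_4) : R :=
  - (A 0 1 * B 0 1) + A 0 2 * B 0 2 + A 0 3 * B 0 3
  + A 1 2 * B 1 2 + A 1 3 * B 1 3 - A 2 3 * B 2 3.

Lemma biv_metric_wedge (R : realType) (v w v' w' : 'rV[R]_4) :
  biv_metric (wedge v w) (wedge v' w') =
  dot22 v w' * dot22 w v' - dot22 v v' * dot22 w w'.
Proof. by rewrite /biv_metric /dot22 !mxE !big_ord1 !mxE; ring. Qed.

(* A ^ B = [wedge22 A B] Omega, where Omega = e_1 ^ e_2 ^ e_3 ^ e_4 *)
Definition wedge22 (R : realType) (A B : 'M[R]_4) : R :=
  A 0 1 * B 2 3 - A 0 2 * B 1 3 + A 0 3 * B 1 2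
  + A 1 2 * B 0 3 - A 1 3 * B 0 2 + A 2 3 * B 0 1.

(* [star_of B B']: B' is the image of B under the star operator *)
Definition star_of (R : realType) (B B' : 'M[R]_4) : Prop :=
  bivector B' /\
  forall A, bivector A -> wedge22 A B' = biv_metric A B.

(* the eigenspace of the star operator for the eigenvalue eps = 1 or -1 *)
Definition star_eigen (R : realType) (eps : R) : set 'M[R]_4 :=
  [set B | bivector B /\ star_of B (eps *: B)].

(* On the two-sheeted hyperboloid of [star_eigen eps] the coordinate along
   e_1 ^ e_2 does not vanish; the sheet where it is positive is chosen. *)
Definition hyp_plane (R : realType) (eps : R) : set 'M[R]_4 :=
  [set A | [/\ star_eigen eps A, biv_metric A A = -1 & 0 < A 0 1]].

Definition tan_hyp_plane (R : realType) (eps : R) (A : 'M[R]_4) :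
  set 'M[R]_4 := [set X | star_eigen eps X /\ biv_metric X A = 0].

Definition to_sheet (R : realType) (A : 'M[R]_4) : 'M[R]_4 :=
  if 0 < A 0 1 then A else - A.

(* The Gauss map component of sign eps = 1 or -1, before the identification
   of the two sheets.  [wedge] of an oriented orthonormal frame does not depend
   on the frame. *)
Definition gauss_component (R : realType) (S : riemannSurface R) (eps : R)
    (phi N : S -> 'rV[R]_4) (nu : S -> 'M[R]_4) : Prop :=
  forall c, atlas c -> forall w, conf_dom c w ->
    let f := local c phi in
    forall e, orthonormal_frame (@dot22 R) f w e -> oriented e ->
      local c nu w = (Num.sqrt 2)^-1 *:
        (wedge ('D_(e 0) f w) ('D_(e 1) f w)
         + eps *: wedge (local c N w) (f w)).

Definition hyp_prod (R : realType) : set ('M[R]_4 * 'M[R]_4) :=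
  [set a | hyp_plane 1 a.1 /\ hyp_plane (-1) a.2].

Definition tan_hyp_prod (R : realType) (a : 'M[R]_4 * 'M[R]_4) :
  set ('M[R]_4 * 'M[R]_4) :=
  [set X | tan_hyp_plane 1 a.1 X.1 /\ tan_hyp_plane (-1) a.2 X.2].

Definition prod_metric (R : realType) (X Y : 'M[R]_4 * 'M[R]_4) : R :=
  biv_metric X.1 Y.1 + biv_metric X.2 Y.2.

Definition nu_map (R : realType) (S : riemannSurface R)
    (nup num : S -> 'M[R]_4) (p : S) : 'M[R]_4 * 'M[R]_4 :=
  (to_sheet (nup p), to_sheet (num p)).

Definition conformal_minimal_HH (R : realType) (S : riemannSurface R)
    (nu : S -> 'M[R]_4 * 'M[R]_4) : Prop :=
  (forall p, hyp_prod (nu p)) /\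
  [/\ immersion nu, conformal (@prod_metric R) nu &
      zero_mean_curvature (@prod_metric R) (@tan_hyp_prod R) nu].

(* Main.v *)
Require Import Defs.
From HB Require Import structures.
From mathcomp Require Import all_boot all_order all_algebra complex.
From mathcomp Require Import all_classical all_reals all_analysis.
From mathcomp Require Import ring lra.
Import Order.TTheory GRing.Theory Num.Theory.
Import numFieldNormedType.Exports.
Set Implicit Arguments.
Unset Strict Implicit.
Unset Printing Implicit Defensive.
Local Open Scope classical_set_scope.
Local Open Scope complex_scope.
Local Open Scope ring_scope.

(** Let f be a conformal spacelike maximal immersion read in a conformal
parameter, n its unit normal, l its conformal factor, and let
L = <f_xx, n>, M = <f_xy, n>.  Maximality says <f_yy, n> = - L, and the Hopf
differential is - (L - i M) / 2.  Everything is read off the unit bivector of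
the tangent plane, A = l^-1 f_x ^ f_y ([tangent_biv]): as the frame
(f_x, f_y, f, n) is positive and orthogonal, the star operator sends A to
n ^ f ([hodge_tangent_biv]), so that the components of the Gauss map are the
images of A under the constant linear maps (1 + eps star) / sqrt 2.

The formulas of Gauss and Weingarten give
   A_x = f ^ f_y - n ^ n_y   and   A_y = n ^ n_x - f ^ f_x
([tangent_biv_dx], [tangent_biv_dy]).  Differentiating once more, the mixed
second derivatives of f and of n cancel and what remains is
   A_xx + A_yy = 2 f_x ^ f_y - 2 n_x ^ n_y = 2 (l + (L^2 + M^2) / l) A
([tangent_biv_laplacian]).  Applying the constant linear maps, the Laplacian of
each component of the Gauss map is a multiple of that component: both
components are harmonic maps into hyperbolic planes.

For the metric, the product of the derivatives of a component of sign eps along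
u and v is g(A_u, A_v) + eps A_u ^ A_v.  The first term is
(l + (L^2 + M^2) / l) <u, v> ([tangent_biv_metric]), and the second one depends
on L and M only ([tangent_biv_wedge22]), that is, on the Hopf differential.  So
neither component is conformal in general, but when the components of sign 1 of
phi and of sign -1 of psi are combined, with equal Hopf differentials, the
second terms cancel ([prod_first_ff]).  Since |sigma|^2 = 2 (L^2 + M^2) / l^2,
the factor l + (L^2 + M^2) / l is (2 + |sigma|^2) l / 2, which is the
announced metric; and a conformal harmonic map is minimal
([conformal_harmonic_minimal]).

The identification of the two sheets of each hyperboloid multiplies a component
by a sign.  This sign is locally constant, because the coordinate along
e_1 ^ e_2 is continuous and vanishes nowhere ([gauss_map_sheet]); smoothness,
metric and mean curvature being local, it does no harm.

On the analytic side the proof rests on the closure of smooth maps under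
continuous bilinear maps ([Ck_bilinear]), which also gives the smoothness of n,
recovered from A and f by contraction ([Ck_normal]), and on the symmetry of
second derivatives ([schwarz_mx]). *)

(** * Calculus of smooth maps on open subsets of the plane *)

Section Calculus.
Context {R : realType}.
Implicit Types (U : set (R * R)) (w u v : R * R) (k : nat).

Lemma open_near U (P : set (R * R)) w :
  open U -> U w -> (forall w', U w' -> P w') -> \forall w' \near w, P w'.
Proof.
move=> oU Uw UP; apply: filterS UP _; exact: open_nbhs_nbhs.
Qed.

(** The difference of the two maps vanishes near the point, so it is
differentiable there with zero differential. *)
Lemma near_differentiable (V W : normedModType R) (f g : V -> W) x :
  (\forall y \near x, f y = g y) -> differentiable f x -> differentiable g x.
Proof.
move=> fg df.
have E : (g - f) \o shift x = cst ((g - f) x) + (\0 : {linear V -> W}) +o_ 0 id.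
  apply/eqaddoP => _/posnumP[e].
  have fgx : f x = g x by exact: (nbhs_singleton fg).
  have : \forall y \near (0 : V), f (y + x) = g (y + x).
    by move: fg; rewrite [\forall y \near x, _](near_shift 0) /= subr0.
  apply: filterS => y fgy /=.
  rewrite !fctE /= fgy fgx !subrr addr0 subrr normr0; exact: mulr_ge0.
have dh : differentiable (g - f) x.
  apply/diff_locallyP.
  have D0 : 'd (g - f) x = (\0 : {linear V -> W}) :> (V -> W).
    by apply: (diff_unique _ E) => y; exact: cvg_cst.
  by rewrite D0; split => // y; exact: cvg_cst.
by rewrite -(subrK f g); exact: differentiableD.
Qed.

Lemma Ck_congr (V : normedModType R) k U (f g : R * R -> V) :
  open U -> (forall w, U w -> f w = g w) -> Ck k U f -> Ck k U g.
Proof.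
elim: k f g => [|k IH] f g oU fg /=.
  move=> cf w Uw; have nfg : \forall w' \near w, f w' = g w'.
    exact: open_near oU Uw fg.
  move: (cf w Uw); rewrite /prop_for/continuous_at -(fg w Uw) => cfw.
  by apply: cvg_trans cfw; apply: near_eq_cvg.
move=> [df Cf]; split.
  move=> w Uw; have nfg : \forall w' \near w, f w' = g w'.
    exact: open_near oU Uw fg.
  exact: near_differentiable nfg (df _ Uw).
move=> u; apply: (IH ('D_u f)) => // w Uw.
apply: near_eq_derive; exact: open_near oU Uw fg.
Qed.

Lemma Ck_sub (V : normedModType R) k U U' (f : R * R -> V) :
  U' `<=` U -> Ck k U f -> Ck k U' f.
Proof.
elim: k f => [|k IH] f sU /=; first by move=> cf w /sU /cf.
by move=> [df Cf]; split=> [w /sU /df|u] //; exact: IH.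
Qed.

(** The conditions in [Ck] are imposed point by point, so a neighbourhood on
which they hold may be chosen at each point; this is how a map that is smooth
up to a locally constant sign is handled. *)
Lemma Ck_local (V : normedModType R) k U (f : R * R -> V) :
  (forall w, U w -> exists2 Q : set (R * R), Q w & Ck k Q f) ->
  Ck k U f.
Proof.
elim: k f => [|k IH] f /= H; first by move=> w /H [Q Qw /(_ w Qw)].
split=> [w /H [Q Qw [+ _]]|u]; first by move=> /(_ w Qw).
by apply: IH => w /H [Q Qw [_ C]]; exists Q.
Qed.

Lemma CkW (V : normedModType R) k U (f : R * R -> V) :
  Ck k.+1 U f -> Ck k U f.
Proof.
elim: k f => [|k IH] f [df Cf] /=.
  by move=> w Uw; apply: differentiable_continuous; exact: df.
by split=> // u; apply: IH; exact: Cf.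
Qed.

Definition continuous_linear (V W : normedModType R) (L : V -> W) : Prop :=
  linear L /\ continuous L.

Definition continuous_bilinear (V1 V2 W : normedModType R) (b : V1 -> V2 -> W)
  : Prop :=
  [/\ forall y, linear (b^~ y), forall x, linear (b x) &
      continuous (fun p : V1 * V2 => b p.1 p.2)].

Lemma continuous_sum (T : topologicalType) (V : normedModType R) (I : Type)
    (r : seq I) (F : I -> T -> V) :
  (forall i, continuous (F i)) -> continuous (fun x => \sum_(i <- r) F i x).
Proof.
move=> cF x; apply: (@cvg_big _ _ +%R) => [y|i _]; last exact: cF.
exact: add_continuous.
Qed.

Lemma linear_mx_continuous (W : normedModType R) m n (L : 'M[R]_(m, n) -> W) :
  linear L -> continuous L.
Proof.
move=> lL; pose LM := GRing.isLinear.Build _ _ _ _ _ lL.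
pose LL : {linear _ -> _} := HB.pack L LM.
have -> : L = fun M => \sum_i \sum_j M i j *: L (delta_mx i j).
  apply/funext => M; rewrite {1}(matrix_sum_delta M) -[L]/(LL : _ -> _).
  rewrite linear_sum; apply: eq_bigr => i _; rewrite linear_sum.
  by apply: eq_bigr => j _; rewrite linearZ.
apply: continuous_sum => i; apply: continuous_sum => j M.
apply: continuousZr_tmp; exact: (@matrix_normedtype.coord_continuous R).
Qed.

(** Expanding the first argument in coordinates leaves products of coordinate
functions and linear maps. The wedge product, the metrics and the contractions
are thereby all within reach of the Leibniz rule [derive_bilinear]. *)
Lemma bilinear_mx_continuous (W : normedModType R) m n p q
    (b : 'M[R]_(m, n) -> 'M[R]_(p, q) -> W) :
  (forall y, linear (b^~ y)) -> (forall x, linear (b x)) ->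
    continuous_bilinear b.
Proof.
move=> bl br; split=> //.
have E : (fun z : 'M[R]_(m, n) * 'M[R]_(p, q) => b z.1 z.2) = fun z =>
    \sum_i \sum_j z.1 i j *: b (delta_mx i j) z.2.
  apply/funext => z; pose LM := GRing.isLinear.Build _ _ _ _ _ (bl z.2).
  pose LL : {linear _ -> _} := HB.pack (b^~ z.2) LM.
  rewrite {1}(matrix_sum_delta z.1) -[LHS]/(LL _) linear_sum.
  apply: eq_bigr => i _; rewrite linear_sum; apply: eq_bigr => j _.
  by rewrite linearZ.
rewrite E; apply: continuous_sum => i; apply: continuous_sum => j z.
apply: continuousZ.
  apply: (@continuous_comp _ _ R fst (fun M : 'M[R]_(m, n) => M i j : R));
    first exact: cvg_fst.
  exact: (@matrix_normedtype.coord_continuous R).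
apply: (@continuous_comp _ _ _ snd (b (delta_mx i j))); first exact: cvg_snd.
exact: linear_mx_continuous.
Qed.

Section Rules.
Variable E : normedModType R.

Lemma linear_differentiable_comp (V W : normedModType R) (L : V -> W)
  (f : E -> V) (w : E) :
  continuous_linear L -> differentiable f w ->
    differentiable (fun x => L (f x)) w.
Proof.
move=> [lL cL] df; pose LM := GRing.isLinear.Build _ _ _ _ _ lL.
pose LL : {linear _ -> _} := HB.pack L LM.
apply: (differentiable_comp df); rewrite -[L]/(LL : _ -> _).
exact: linear_differentiable.
Qed.

Lemma derive_linear (V W : normedModType R) (L : V -> W) (f : E -> V) (w u : E)
  :
  continuous_linear L -> differentiable f w ->
  'D_u (fun x => L (f x)) w = L ('D_u f w).
Proof.
move=> cl df; rewrite !deriveE //; last exact: linear_differentiable_comp.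
case: cl => [lL cL]; pose LM := GRing.isLinear.Build _ _ _ _ _ lL.
pose LL : {linear _ -> _} := HB.pack L LM.
have dL : differentiable (LL : V -> W) (f w) by exact: linear_differentiable.
have DL : 'd L (f w) = L :> (V -> W) by exact: (@diff_lin R V W LL (f w) cL).
rewrite -[X in 'd X w]/(L \o f).
by rewrite (diff_comp df dL) /= DL.
Qed.

Lemma bilinear_differentiable_comp (V1 V2 W : normedModType R)
  (b : V1 -> V2 -> W)
    (f : E -> V1) (g : E -> V2) (w : E) :
  continuous_bilinear b -> differentiable f w -> differentiable g w ->
  differentiable (fun x => b (f x) (g x)) w.
Proof.
move=> [bl br cb] df dg.
pose bM := bilinear_isBilinear.Build R V1 V2 W _ _ b (conj bl br).
pose bb : {bilinear _ -> _ -> _} := HB.pack b bM.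
have db := @differentiable_bilin R V1 V2 W bb (f w, g w) cb.
exact: (differentiable_comp (differentiable_pair df dg) db).
Qed.

Lemma derive_bilinear (V1 V2 W : normedModType R) (b : V1 -> V2 -> W)
    (f : E -> V1) (g : E -> V2) (w u : E) :
  continuous_bilinear b -> differentiable f w -> differentiable g w ->
  'D_u (fun x => b (f x) (g x)) w = b ('D_u f w) (g w) + b (f w) ('D_u g w).
Proof.
move=> cbil df dg; rewrite !deriveE //;
  last exact: bilinear_differentiable_comp.
case: cbil => [bl br cb].
pose bM := bilinear_isBilinear.Build R V1 V2 W _ _ b (conj bl br).
pose bb : {bilinear _ -> _ -> _} := HB.pack b bM.
have db := @differentiable_bilin R V1 V2 W bb (f w, g w) cb.
have dfg := differentiable_pair df dg.
rewrite -[X in 'd X w]/((fun p => b p.1 p.2) \o (fun x => (f x, g x))).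
rewrite (diff_comp dfg db) /= (@diff_bilin R V1 V2 W bb (f w, g w) cb) /=.
by rewrite diff_pair //= addrC.
Qed.

Lemma derive_pair (V W : normedModType R) (f : E -> V) (g : E -> W) (w u : E) :
  differentiable f w -> differentiable g w ->
  'D_u (fun x => (f x, g x)) w = ('D_u f w, 'D_u g w).
Proof.
move=> df dg; rewrite !deriveE //; last exact: differentiable_pair.
by rewrite diff_pair.
Qed.

End Rules.

Lemma scale_bilinear (V : normedModType R) : continuous_bilinear
  ( *:%R : R -> V -> V).
Proof.
split=> [y|x|]; first by move=> a x x'; rewrite scalerDl scalerA.
  by move=> a y y'; rewrite scalerDr !scalerA mulrC.
by move=> p; exact: scale_continuous.
Qed.

Lemma Ck_linear (V W : normedModType R) (L : V -> W) k U (f : R * R -> V) :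
  open U -> continuous_linear L -> Ck k U f -> Ck k U (fun w => L (f w)).
Proof.
move=> oU cL; elim: k f => [|k IH] f /=.
  move=> cf w Uw; apply: (@continuous_comp _ _ _ f L); first exact: cf.
  exact: cL.2.
move=> [df Cf]; split=> [w /df|u]; first exact: linear_differentiable_comp.
apply: Ck_congr (IH _ (Cf u)) => // w Uw.
by rewrite [RHS]derive_linear //; exact: df.
Qed.

Lemma CkD (V : normedModType R) k U (f g : R * R -> V) :
  open U -> Ck k U f -> Ck k U g -> Ck k U (fun w => f w + g w).
Proof.
move=> oU; elim: k f g => [|k IH] f g /=.
  by move=> cf cg w Uw; apply: cvgD; [exact: cf|exact: cg].
move=> [df Cf] [dg Cg]; split=> [w Uw|u].
  by apply: differentiableD; [exact: df|exact: dg].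
apply: Ck_congr (IH _ _ (Cf u) (Cg u)) => // w Uw.
by rewrite -deriveD //; apply: diff_derivable; [exact: df|exact: dg].
Qed.

(** By the Leibniz rule the derivative is a sum of two terms of the same kind,
where one of the factors has lost a derivative and the other one has not;
hence the use of [CkW] in the induction. *)
Lemma Ck_bilinear (V1 V2 W : normedModType R) (b : V1 -> V2 -> W) k U
    (f : R * R -> V1) (g : R * R -> V2) :
  open U -> continuous_bilinear b -> Ck k U f -> Ck k U g ->
  Ck k U (fun w => b (f w) (g w)).
Proof.
move=> oU cb; elim: k f g => [|k IH] f g.
  move=> /= cf cg w Uw; case: cb => _ _ cb.
  apply: (@continuous_comp _ _ _ (fun w => (f w, g w)) (fun p => b p.1 p.2)).
    by apply: cvg_pair; [exact: cf|exact: cg].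
  exact: cb.
move=> Cf Cg; have [[df Df] [dg Dg]] := (Cf, Cg); split=> [w Uw|u].
  by apply: bilinear_differentiable_comp => //; [exact: df|exact: dg].
apply: Ck_congr (CkD oU (IH _ _ (Df u) (CkW Cg))
  (IH _ _ (CkW Cf) (Dg u))) => //.
by move=> w Uw; rewrite [RHS]derive_bilinear //; [exact: df|exact: dg].
Qed.

Lemma Ck_pair (V W : normedModType R) k U (f : R * R -> V) (g : R * R -> W) :
  open U -> Ck k U f -> Ck k U g -> Ck k U (fun w => (f w, g w)).
Proof.
move=> oU; elim: k f g => [|k IH] f g /=.
  by move=> cf cg w Uw; apply: cvg_pair; [exact: cf|exact: cg].
move=> [df Cf] [dg Cg]; split=> [w Uw|u].
  by apply: differentiable_pair; [exact: df|exact: dg].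
apply: Ck_congr (IH _ _ (Cf u) (Cg u)) => // w Uw.
by rewrite [RHS]derive_pair //; [exact: df|exact: dg].
Qed.

Lemma CkM k U (f g : R * R -> R) :
  open U -> Ck k U f -> Ck k U g -> Ck k U (fun w => f w * g w).
Proof.
by move=> oU Cf Cg; apply: (Ck_bilinear oU (@scale_bilinear R)).
Qed.

(** The derivative of 1 / f is - (1 / f) (1 / f) f', a product to which the
induction hypothesis applies. *)
Lemma CkV k U (f : R * R -> R) :
  open U -> (forall w, U w -> f w != 0) -> Ck k U f ->
  Ck k U (fun w => (f w)^-1).
Proof.
move=> oU f0; elim: k => [|k IH].
  by move=> /= cf w Uw; apply: cvgV; [exact: f0|exact: cf].
move=> Cf; have [df Df] := Cf; split=> [w Uw|u].
  by apply: differentiableV; [exact: df|exact: f0].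
have Cg := IH (CkW Cf).
have C1 : Ck k U (fun w => - ((f w)^-1 * ((f w)^-1 * 'D_u f w))).
  apply: (@Ck_linear R R (fun x => - x)) => //.
    by split=> [a x y|]; [rewrite opprD scalerN|exact: opp_continuous].
  exact: (CkM oU Cg (CkM oU Cg (Df u))).
apply: Ck_congr C1 => // w Uw.
rewrite deriveV; [|exact: f0|by apply: diff_derivable; exact: df].
by rewrite -mulNr -[RHS]/(_ * _) expr2 invfM mulNr mulNr mulrA.
Qed.

End Calculus.

(** * Symmetry of second derivatives *)

Section Schwarz.
Context {R : realType}.
Implicit Types (U : set (R * R)).

(** The mean value theorem is applied to the difference of the two horizontal
sides of the rectangle, then to the derivative so obtained. *)
Lemma rectangle_MVT (g gx gxy : R -> R -> R) (a b h : R) :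
  0 < h ->
  (forall t s, t \in `[a, a + h] -> s \in `[b, b + h] ->
     is_derive t 1 (g^~ s) (gx t s)) ->
  (forall t s, t \in `[a, a + h] -> s \in `[b, b + h] ->
     is_derive s 1 (gx t) (gxy t s)) ->
  exists t s, [/\ t \in `[a, a + h], s \in `[b, b + h] &
    g (a + h) (b + h) - g (a + h) b - g a (b + h) + g a b = gxy t s * (h * h)].
Proof.
move=> h0 dx dy.
have bb : b \in `[b, b + h] by rewrite in_itv /= lexx lerDl ltW.
have bh : b + h \in `[b, b + h] by rewrite in_itv /= lexx lerDl ltW.
pose F t := g t (b + h) - g t b.
have dF t : t \in `[a, a + h] -> is_derive t 1 F (gx t (b + h) - gx t b).
  by move=> tab; apply: is_deriveB; exact: dx.
have aah : a < a + h by rewrite ltrDl.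
have bbh : b < b + h by rewrite ltrDl.
have cF : {within `[a, a + h], continuous F}.
  by apply: derivable_within_continuous => t /dF [].
have dF' t : t \in `]a, a + h[ -> is_derive t 1 F (gx t (b + h) - gx t b).
  by move=> tab; apply: dF; exact: subset_itv_oo_cc.
have [t tab Ft] := MVT aah dF' cF.
have tab' : t \in `[a, a + h] by exact: subset_itv_oo_cc.
have cG : {within `[b, b + h], continuous (gx t)}.
  by apply: derivable_within_continuous => s sab; case: (dy t s tab' sab).
have dG s : s \in `]b, b + h[ -> is_derive s 1 (gx t) (gxy t s).
  by move=> sab; apply: dy => //; exact: subset_itv_oo_cc.
have [s sab Gs] := MVT bbh dG cG.
exists t, s; split => //; first by exact: subset_itv_oo_cc.
move: Ft; rewrite Gs /F (addrC a) (addrC b) !addrK => Ft.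
by rewrite mulrA -Ft; ring.
Qed.

Lemma is_derive_row (V : normedModType R) (g : R * R -> V) t s :
  differentiable g (t, s) ->
  is_derive t 1 (fun t => g (t, s)) ('D_(dx R) g (t, s)).
Proof.
move=> /(@diff_derivable _ _ _ g _ (dx R)) dg.
have E : (fun h : R => h^-1 *: (g (h *: dx R + (t, s)) - g (t, s))) =
    (fun h : R => h^-1 *: (g (h *: (1 : R) + t, s) - g (t, s))).
  apply/funext => h; congr (_ *: (g _ - _)).
  by rewrite /dx; congr (_, _); rewrite /= scaler0 add0r.
split; first by move: dg; rewrite /derivable /= E.
by rewrite /derive /= E.
Qed.

Lemma is_derive_col (V : normedModType R) (g : R * R -> V) t s :
  differentiable g (t, s) ->
  is_derive s 1 (fun s => g (t, s)) ('D_(dy R) g (t, s)).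
Proof.
move=> /(@diff_derivable _ _ _ g _ (dy R)) dg.
have E : (fun h : R => h^-1 *: (g (h *: dy R + (t, s)) - g (t, s))) =
    (fun h : R => h^-1 *: (g (t, h *: (1 : R) + s) - g (t, s))).
  apply/funext => h; congr (_ *: (g _ - _)).
  by rewrite /dy; congr (_, _); rewrite /= scaler0 add0r.
split; first by move: dg; rewrite /derivable /= E.
by rewrite /derive /= E.
Qed.

Local Opaque dx dy.

(** The second difference of [g] over a small square can be computed in two
orders: it is the area times a value of either mixed derivative at a point of
the square. By continuity these values tend to the mixed derivatives at the
corner. *)
Lemma schwarz_real U (g : R * R -> R) w :
  open U -> Ck 2 U g -> U w ->
  'D_(dx R) ('D_(dy R) g) w = 'D_(dy R) ('D_(dx R) g) w.
Proof.
case: w => a b oU [dg Cg] Uw.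
have [dgx Cgx] := Cg (dx R); have [dgy Cgy] := Cg (dy R).
apply/eqP; rewrite -subr_eq0 -normr_le0 leNgt; apply/negP.
set A := 'D_(dx R) ('D_(dy R) g) (a, b).
set B := 'D_(dy R) ('D_(dx R) g) (a, b).
set e := `|A - B| => e0.
have e2 : 0 < e / 2 by rewrite divr_gt0.
have /cvgrPdist_lt /(_ _ e2) nA := Cgy (dx R) _ Uw.
have /cvgrPdist_lt /(_ _ e2) nB := Cgx (dy R) _ Uw.
have nU := open_nbhs_nbhs (conj oU Uw).
have [r /= r0 rP] := (nbhs_ballP _ _).1 (filterI (filterI nA nB) nU).
(* The square of side r / 2 with lower left corner (a, b) lies in the ball. *)
pose h := r / 2.
have h0 : 0 < h by rewrite divr_gt0.
have hr : h < r by rewrite /h ltr_pdivrMr // ltr_pMr // ltr1n.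
have inb t s : t \in `[a, a + h] -> s \in `[b, b + h] -> ball (a, b) r (t, s).
  rewrite !in_itv /= => /andP[at1 at2] /andP[bs1 bs2].
  by split; rewrite /ball /= distrC ger0_norm ?subr_ge0 //; lra.
have inU t s : t \in `[a, a + h] -> s \in `[b, b + h] -> U (t, s).
  by move=> ht hs; have [] := rP _ (inb _ _ ht hs).
have [||t [s [ht hs E1]]] := @rectangle_MVT (fun t s => g (t, s))
    (fun t s => 'D_(dx R) g (t, s)) (fun t s => 'D_(dy R) ('D_(dx R) g) (t, s))
    a b h h0.
- by move=> t s ht hs; apply: is_derive_row; apply: dg; exact: inU.
- by move=> t s ht hs; apply: is_derive_col; apply: dgx; exact: inU.
have [||s' [t' [hs' ht' E2]]] := @rectangle_MVT (fun s t => g (t, s))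
    (fun s t => 'D_(dy R) g (t, s)) (fun s t => 'D_(dx R) ('D_(dy R) g) (t, s))
    b a h h0.
- by move=> s1 t1 ht1 hs1; apply: is_derive_col; apply: dg; exact: inU.
- by move=> s1 t1 ht1 hs1; apply: is_derive_row; apply: dgy; exact: inU.
have [[_ Bts] _] := rP _ (inb _ _ ht hs).
have [[Ats _] _] := rP _ (inb _ _ ht' hs').
have hh : h * h != 0 by rewrite mulf_neq0 // gt_eqF.
have E : 'D_(dy R) ('D_(dx R) g) (t, s) = 'D_(dx R) ('D_(dy R) g) (t', s').
  apply: (mulIf hh); apply: (etrans (esym E1) (etrans _ E2)).
  by congr (_ + _); exact: addrAC.
set C := 'D_(dx R) ('D_(dy R) g) (t', s') in E.
have AC : `|A - C| < e / 2 := Ats.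
have BC : `|B - C| < e / 2 by rewrite -E; exact: Bts.
have := ltrD AC BC; rewrite -splitr ltNge => /negP; apply.
have -> : e = `|(A - C) - (B - C)| by rewrite /e; congr `|_|; ring.
exact: ler_normB.
Qed.

Lemma derive_entry m n (f : R * R -> 'M[R]_(m, n)) w u i j :
  differentiable f w -> 'D_u f w i j = 'D_u (fun x => f x i j) w.
Proof. by move=> df; rewrite derive_mx ?mxE //; exact: diff_derivable. Qed.

Lemma schwarz_mx U m n (f : R * R -> 'M[R]_(m, n)) w :
  open U -> Ck 2 U f -> U w ->
  'D_(dx R) ('D_(dy R) f) w = 'D_(dy R) ('D_(dx R) f) w.
Proof.
move=> oU Cf Uw; apply/matrixP => i j.
have cij : continuous_linear (fun M : 'M[R]_(m, n) => M i j : R).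
  by split=> [a M N|]; [rewrite !mxE|exact:
    (@matrix_normedtype.coord_continuous R)].
have [df Df] := Cf.
have Cij : Ck 2 U (fun x => f x i j) := Ck_linear oU cij Cf.
have E u v : 'D_u ('D_v f) w i j = 'D_u ('D_v (fun x => f x i j)) w.
  rewrite derive_entry; last by apply: (Df v).1.
  apply: near_eq_derive; apply: open_near oU Uw _ => x Ux.
  by rewrite derive_entry //; exact: df.
have S := schwarz_real oU Cij Uw.
have E1 := E (dx R) (dy R).
have E2 := E (dy R) (dx R).
exact: (etrans E1 (etrans S (esym E2))).
Qed.

End Schwarz.

(** * The star operator and the wedge product on bivectors *)

Section Algebra.
Context {R : realType}.
Implicit Types (a b c d v : 'rV[R]_4) (A B : 'M[R]_4).

(** The star operator. Its entries solve the equation [wedge22 A (hodge B) =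
biv_metric A B] for [A] ranging over the basis bivectors; only the entries of
[B] above the diagonal enter the part above the diagonal. *)
Definition hodge B : 'M[R]_4 :=
  \matrix_(i, j) nth 0 (nth [::] [:: [:: 0; - B 2 3; - B 1 3; B 1 2];
                      [:: B 2 3; 0; B 0 3; - B 0 2];
                      [:: B 1 3; - B 0 3; 0; - B 0 1];
                      [:: - B 1 2; B 0 2; B 0 1; 0]] i) j.

Lemma biv_metric_hodge A B : biv_metric A (hodge B) = wedge22 A B.
Proof. rewrite /biv_metric /wedge22 !mxE /=. ring. Qed.

Lemma biv_metric_hodge2 A B : biv_metric (hodge A) (hodge B) = biv_metric A B.
Proof. rewrite /biv_metric !mxE /=. ring. Qed.

Lemma wedge22_hodge A B : wedge22 A (hodge B) = biv_metric A B.
Proof. rewrite /biv_metric /wedge22 !mxE /=. ring. Qed.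

(** Laplace expansion of the determinant along its first two rows. It makes
the orientation of a frame visible to the exterior algebra. *)
Lemma det_wedge22 a b c d :
  \det (rows4 a b c d) = wedge22 (wedge a b) (wedge c d).
Proof.
(* Columns are indexed by numbers, so that the lifts of ordinals created by the
   row expansions can be computed. *)
pose e (v : 'rV[R]_4) (k : nat) := v 0 (inord k).
have -> : rows4 a b c d = \matrix_(i < 4, j < 4) e [:: a; b; c; d]`_i j.
  by apply/matrixP => i j; rewrite !mxE /e inord_val.
have E (v : 'rV[R]_4) j : v 0 j = e v j by rewrite /e inord_val.
rewrite [RHS]/wedge22 /wedge !mxE !big_ord1 !mxE !E.
rewrite (expand_det_row _ 0) !big_ord_recl !big_ord0 /cofactor.
rewrite !(expand_det_row _ 0) !big_ord_recl !big_ord0 /cofactor.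
rewrite !(expand_det_row _ 0) !big_ord_recl !big_ord0 /cofactor !det_mx11.
rewrite !mxE /= /bump /=.
ring.
Qed.

End Algebra.

(** * Frames adapted to the metric of signature (2, 2) *)

Section Algebra.
Context {R : realType}.
Implicit Types (a b c d u v w : 'rV[R]_4) (A B C : 'M[R]_4) (k : R).

Lemma ord4_ind (P : 'I_4 -> Prop) : P 0 -> P 1 -> P 2 -> P 3 -> forall i, P i.
Proof.
by move=> P0 P1 P2 P3 [[|[|[|[|//]]]] Hi];
  [move: P0|move: P1|move: P2|move: P3]; congr P; apply: val_inj.
Qed.

Lemma sum4 (F : 'I_4 -> R) : \sum_i F i = F 0 + F 1 + F 2 + F 3.
Proof.
rewrite !big_ord_recl big_ord0 addr0 !addrA.
by congr (F _ + F _ + F _ + F _); apply: val_inj.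
Qed.

Lemma dot22C u v : dot22 u v = dot22 v u.
Proof. by rewrite /dot22; ring. Qed.
Lemma dot22Dl u v w : dot22 (u + v) w = dot22 u w + dot22 v w.
Proof. by rewrite /dot22 !mxE; ring. Qed.
Lemma dot22Zl k u w : dot22 (k *: u) w = k * dot22 u w.
Proof. by rewrite /dot22 !mxE; ring. Qed.
Lemma dot22Nl u w : dot22 (- u) w = - dot22 u w.
Proof. by rewrite /dot22 !mxE; ring. Qed.
Lemma dot22Dr u v w : dot22 w (u + v) = dot22 w u + dot22 w v.
Proof. by rewrite /dot22 !mxE; ring. Qed.
Lemma dot22Zr k u w : dot22 w (k *: u) = k * dot22 w u.
Proof. by rewrite /dot22 !mxE; ring. Qed.
Lemma dot22Nr u w : dot22 w (- u) = - dot22 w u.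
Proof. by rewrite /dot22 !mxE; ring. Qed.
Definition dot22E := (dot22Dl, dot22Zl, dot22Nl, dot22Dr, dot22Zr, dot22Nr).

Definition signature22 : 'rV[R]_4 := \row_j (if (j < 2)%N then 1 else -1).

Lemma gram_entry (P Q : 'M[R]_4) i j :
  (P *m diag_mx signature22 *m Q^T) i j = dot22 (row i P) (row j Q).
Proof. by rewrite mul_mx_diag mxE sum4 /dot22 !mxE /=; ring. Qed.

Lemma wedge_delta i j :
  wedge (delta_mx 0 i) (delta_mx 0 j) = delta_mx i j - delta_mx j i :> 'M[R]_4.
Proof. by rewrite /wedge !trmx_delta !mul_delta_mx. Qed.

(** The pairing given by the wedge product is nondegenerate on bivectors: up
to sign, pairing with a basis bivector extracts the complementary coordinate.
*)
Lemma bivector_eq0 A :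
  (forall i j, A j i = - A i j) ->
  (forall i j, wedge22 (wedge (delta_mx 0 i) (delta_mx 0 j)) A = 0) -> A = 0.
Proof.
move=> aA A0.
have W i j : A i j = 0 -> A j i = 0 by move=> Aij; rewrite aA Aij oppr0.
have D i : A i i = 0 by have := aA i i; lra.
have A01 : A 0 1 = 0.
  by have := A0 2 3; rewrite wedge_delta /wedge22 !mxE /=; lra.
have A02 : A 0 2 = 0.
  by have := A0 1 3; rewrite wedge_delta /wedge22 !mxE /=; lra.
have A03 : A 0 3 = 0.
  by have := A0 1 2; rewrite wedge_delta /wedge22 !mxE /=; lra.
have A12 : A 1 2 = 0.
  by have := A0 0 3; rewrite wedge_delta /wedge22 !mxE /=; lra.
have A13 : A 1 3 = 0.
  by have := A0 0 2; rewrite wedge_delta /wedge22 !mxE /=; lra.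
have A23 : A 2 3 = 0.
  by have := A0 0 1; rewrite wedge_delta /wedge22 !mxE /=; lra.
apply/matrixP => i j; rewrite [RHS]mxE.
by elim/ord4_ind: i; elim/ord4_ind: j; auto.
Qed.

Lemma biv_metricDl A B C : biv_metric (A + B) C =
  biv_metric A C + biv_metric B C.
Proof. by rewrite /biv_metric !mxE; ring. Qed.
Lemma biv_metricZl k A C : biv_metric (k *: A) C = k * biv_metric A C.
Proof. by rewrite /biv_metric !mxE; ring. Qed.
Lemma biv_metricDr A B C : biv_metric C (A + B) =
  biv_metric C A + biv_metric C B.
Proof. by rewrite /biv_metric !mxE; ring. Qed.
Lemma biv_metricZr k A C : biv_metric C (k *: A) = k * biv_metric C A.
Proof. by rewrite /biv_metric !mxE; ring. Qed.

Section Frame.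
Variables (p q f n : 'rV[R]_4) (l : R).
Hypotheses (l0 : 0 < l) (pp : dot22 p p = l) (qq : dot22 q q = l)
  (ff : dot22 f f = -1) (nn : dot22 n n = -1) (pq : dot22 p q = 0)
  (pf : dot22 p f = 0) (pn : dot22 p n = 0) (qf : dot22 q f = 0)
  (qn : dot22 q n = 0) (fn : dot22 f n = 0)
  (dP : 0 < \det (rows4 p q f n)).

Let P := rows4 p q f n.
Let rP i : row i P = [:: p; q; f; n]`_i.
Proof. by apply/rowP => j; rewrite !mxE. Qed.

Let dots := (pp, qq, ff, nn, pq, pf, pn, qf, qn, fn,
  etrans (dot22C q p) pq, etrans (dot22C f p) pf, etrans (dot22C n p) pn,
  etrans (dot22C f q) qf, etrans (dot22C n q) qn, etrans (dot22C n f) fn).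

Let nl : l != 0. Proof. by rewrite gt_eqF. Qed.

(** The difference of the two sides is orthogonal to the four vectors of the
frame, which form an invertible matrix. *)
Lemma frame_expand v :
  v = (dot22 v p / l) *: p + (dot22 v q / l) *: q
      - dot22 v f *: f - dot22 v n *: n.
Proof.
apply/eqP; rewrite -subr_eq0; set r := v - _; apply/eqP.
have r0 i : dot22 (row i P) r = 0.
  rewrite rP; elim/ord4_ind: i; rewrite /= /r dot22Dr dot22Nr !dot22E !dots;
  rewrite !(dot22C v); field; exact: nl.
have uP : P \in unitmx by rewrite unitmxE unitfE gt_eqF.
have uJ : diag_mx signature22 \in unitmx.
  rewrite unitmxE det_diag unitfE; apply/prodf_neq0 => i _.
  by rewrite mxE; case: ifP; rewrite ?oppr_eq0 oner_eq0.
have : P *m diag_mx signature22 *m r^T = 0.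
  apply/colP => i; rewrite [RHS]mxE -(r0 i) /dot22 mul_mx_diag mxE sum4 !mxE /=.
  by ring.
move=> /(congr1 (mulmx (invmx (P *m diag_mx signature22)))).
rewrite mulKmx ?unitmx_mul ?uP // mulmx0 => /(congr1 trmx).
by rewrite trmxK trmx0.
Qed.

(** The Gram matrix of the frame is diag (l, l, -1, -1) and the metric has
determinant 1, so the determinant of the frame squares to l ^ 2; the
orientation selects the root l. *)
Lemma frame_wedge22 : wedge22 (wedge p q) (wedge n f) = - l.
Proof.
have -> : wedge22 (wedge p q) (wedge n f) = - \det P.
  by rewrite det_wedge22 /wedge22 /wedge !mxE !big_ord1 !mxE; ring.
congr (- _).
have : \det (P *m diag_mx signature22 *m P^T) = l ^+ 2.
  have -> : P *m diag_mx signature22 *m P^T =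
      diag_mx (\row_j [:: l; l; -1; -1]`_j).
    apply/matrixP => i j; rewrite gram_entry !rP !mxE.
    by elim/ord4_ind: i; elim/ord4_ind: j; rewrite /= !dots ?mulr1n ?mulr0n.
  rewrite det_diag; under eq_bigr do rewrite mxE.
  by rewrite !big_ord_recl big_ord0 /=; ring.
rewrite !det_mulmx det_tr det_diag.
have -> : \prod_i signature22 0 i = 1.
  by rewrite !big_ord_recl big_ord0 !mxE /=; ring.
rewrite mulr1 -expr2 => /eqP; rewrite eqf_sqr => /orP[/eqP //|/eqP E].
by move: dP; rewrite -/P E oppr_gt0 ltNge ltW.
Qed.

(** Both sides have the same wedge product with every v ^ w: after expansion
of v and w in the frame, the only term of v ^ w that pairs with n ^ f is the
one along p ^ q, and it is also the only one that [biv_metric] pairs with p ^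
q. *)
Lemma hodge_wedge : hodge (wedge p q) = l *: wedge n f.
Proof.
have W v w : wedge22 (wedge v w) (wedge n f) =
    (dot22 v p / l * (dot22 w q / l) - dot22 v q / l * (dot22 w p / l)) * - l.
  rewrite {1}(frame_expand v) {1}(frame_expand w) -frame_wedge22.
  move: (_ / _) (_ / _) (_ / _) (_ / _) (dot22 v f) (dot22 v n) (dot22 w f)
    (dot22 w n).
  move=> *.
  by rewrite /wedge22 /wedge !mxE !big_ord1 !mxE; ring.
have E v w : wedge22 (wedge v w) (hodge (wedge p q) - l *: wedge n f) = 0.
  have -> : forall A B C, wedge22 A (B - l *: C) =
    wedge22 A B - l * wedge22 A C.
    by move=> A B C; rewrite /wedge22 !mxE; ring.
  rewrite W wedge22_hodge biv_metric_wedge; field; exact: nl.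
apply/eqP; rewrite -subr_eq0; apply/eqP.
set Y := _ - _ in E *.
have aY i j : Y j i = - Y i j.
  rewrite /Y /hodge /wedge !mxE !big_ord1 !mxE.
  by elim/ord4_ind: i; elim/ord4_ind: j; rewrite /=; ring.
apply: bivector_eq0 => // i j; exact: E.
Qed.

(** The four bivectors are orthogonal, and each has square l. *)
Lemma frame_metric x1 x2 x3 x4 y1 y2 y3 y4 :
  biv_metric
    (x1 *: wedge f q + x2 *: wedge f p + x3 *: wedge n p + x4 *: wedge n q)
    (y1 *: wedge f q + y2 *: wedge f p + y3 *: wedge n p + y4 *: wedge n q) =
  l * (x1 * y1 + x2 * y2 + x3 * y3 + x4 * y4).
Proof.
have E A B C D A' B' C' D' :
    biv_metric (x1 *: A + x2 *: B + x3 *: C + x4 *: D)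
      (y1 *: A' + y2 *: B' + y3 *: C' + y4 *: D') =
    x1 * (y1 * biv_metric A A' + y2 * biv_metric A B' +
          y3 * biv_metric A C' + y4 * biv_metric A D') +
    x2 * (y1 * biv_metric B A' + y2 * biv_metric B B' +
          y3 * biv_metric B C' + y4 * biv_metric B D') +
    x3 * (y1 * biv_metric C A' + y2 * biv_metric C B' +
          y3 * biv_metric C C' + y4 * biv_metric C D') +
    x4 * (y1 * biv_metric D A' + y2 * biv_metric D B' +
          y3 * biv_metric D C' + y4 * biv_metric D D').
  by rewrite !(biv_metricDl, biv_metricZl, biv_metricDr, biv_metricZr); ring.
rewrite E.
by rewrite !biv_metric_wedge !dots; ring.
Qed.

(** Among these four planes, only the complementary ones, f ^ q with n ^ p and
f ^ p with n ^ q, have a nonzero wedge product. *)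
Lemma frame_cross x1 x2 x3 x4 y1 y2 y3 y4 :
  wedge22
    (x1 *: wedge f q + x2 *: wedge f p + x3 *: wedge n p + x4 *: wedge n q)
    (y1 *: wedge f q + y2 *: wedge f p + y3 *: wedge n p + y4 *: wedge n q) =
  l * (x1 * y3 + x3 * y1 - x2 * y4 - x4 * y2).
Proof.
have -> : l = - wedge22 (wedge p q) (wedge n f) by rewrite frame_wedge22 opprK.
by rewrite /wedge22 !mxE !big_ord1 !mxE; ring.
Qed.

End Frame.
End Algebra.

(** * Maximal surfaces in Anti-De Sitter space in a conformal parameter *)

(** Directional derivatives, locked: comparing derivatives along two different
directions must not unfold them into limits of difference quotients. *)
HB.lock Definition pd (R : realType) (V : normedModType R) (u : R * R)
  (f : R * R -> V) : R * R -> V := 'D_u f.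

Section Surface.
Context {R : realType}.

Lemma pdE (V : normedModType R) (u : R * R) (f : R * R -> V) :
  pd u f = 'D_u f.
Proof. by rewrite pd.unlock. Qed.

Lemma derive_pd (V : normedModType R) (u : R * R) (f : R * R -> V) w :
  'D_u f w = pd u f w.
Proof. by rewrite pdE. Qed.

Lemma wedge_bilinear : continuous_bilinear (@wedge R).
Proof.
apply: bilinear_mx_continuous => x a u v; apply/matrixP => i j;
  rewrite /wedge !mxE !big_ord1 !mxE; ring.
Qed.

Lemma dot22_bilinear : continuous_bilinear (@dot22 R).
Proof.
apply: bilinear_mx_continuous => x a u v; first by rewrite dot22Dl dot22Zl.
by rewrite dot22Dr dot22Zr.
Qed.

(** The contraction of a bivector with a vector, the vector being turned into
a linear form by the metric. *)
Definition contraction (v : 'rV[R]_4) (B : 'M[R]_4) : 'rV[R]_4 :=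
  v *m diag_mx (signature22 (R := R)) *m B^T.

Lemma contraction_bilinear : continuous_bilinear contraction.
Proof.
apply: bilinear_mx_continuous => x a u v; rewrite /contraction.
  by rewrite !mulmxDl !scalemxAl.
by rewrite linearP /= mulmxDr scalemxAr.
Qed.

Lemma contraction_wedge (v a b : 'rV[R]_4) :
  contraction v (wedge a b) = dot22 v b *: a - dot22 v a *: b.
Proof.
apply/rowP => j; rewrite /contraction mul_mx_diag mxE sum4 /wedge !mxE /=.
rewrite !big_ord1 !mxE /dot22 /=; ring.
Qed.

Lemma hodge_linear : continuous_linear (@hodge R).
Proof.
have lh : linear (@hodge R).
  move=> a A B; apply/matrixP => i j; rewrite !mxE.
  by elim/ord4_ind: i; elim/ord4_ind: j; rewrite /=; ring.
split=> //; exact: linear_mx_continuous.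
Qed.

Lemma hodgeZ a (B : 'M[R]_4) : hodge (a *: B) = a *: hodge B.
Proof.
apply/matrixP => i j; rewrite !mxE.
by elim/ord4_ind: i; elim/ord4_ind: j; rewrite /=; ring.
Qed.

Lemma derive_coordinates (V : normedModType R) (g : R * R -> V) w (u : R * R) :
  differentiable g w ->
  'D_u g w = u.1 *: 'D_(dx R) g w + u.2 *: 'D_(dy R) g w.
Proof.
move=> dg; rewrite !deriveE // -!linearZ -linearD; congr ('d g w _).
by case: u => u1 u2; congr (_, _) => /=; rewrite /GRing.scale /=; ring.
Qed.

Lemma wedgeE (v w : 'rV[R]_4) i j :
  wedge v w i j = v 0 i * w 0 j - w 0 i * v 0 j.
Proof. by rewrite /wedge !mxE !big_ord1 !mxE. Qed.

Lemma pd_linear (V W : normedModType R) (L : V -> W) (f : R * R -> V) w u :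
  continuous_linear L -> differentiable f w -> pd u (fun x => L (f x)) w =
    L (pd u f w).
Proof. by rewrite !pdE; exact: derive_linear. Qed.

Lemma pd_bilinear (V1 V2 W : normedModType R) (b : V1 -> V2 -> W)
    (f : R * R -> V1) (g : R * R -> V2) w u :
  continuous_bilinear b -> differentiable f w -> differentiable g w ->
  pd u (fun x => b (f x) (g x)) w = b (pd u f w) (g w) + b (f w) (pd u g w).
Proof. by rewrite !pdE; exact: derive_bilinear. Qed.

Lemma pd_coordinates (V : normedModType R) (g : R * R -> V) w (u : R * R) :
  differentiable g w -> pd u g w = u.1 *: pd (dx R) g w + u.2 *: pd (dy R) g w.
Proof. by rewrite !pdE; exact: derive_coordinates. Qed.

Lemma pdV (f : R * R -> R) u w :
  differentiable f w -> f w != 0 ->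
  pd u (fun x => (f x)^-1) w = - ((f w) ^- 2 * pd u f w).
Proof.
move=> df f0; rewrite !pdE deriveV //; last exact: diff_derivable.
by rewrite -mulNr.
Qed.

Lemma pdB (V : normedModType R) (f g : R * R -> V) u w :
  differentiable f w -> differentiable g w ->
  pd u (fun x => f x - g x) w = pd u f w - pd u g w.
Proof. by move=> df dg; rewrite !pdE -deriveB //; exact: diff_derivable. Qed.

Local Opaque dx dy dot22 wedge wedge22 biv_metric.

Section OpenSet.
Variables (U : set (R * R)).
Hypothesis oU : open U.

Lemma Ck_diff (V : normedModType R) (g : R * R -> V) w :
  (forall k, Ck k U g) -> U w -> differentiable g w.
Proof. by move=> Cg; exact: (Cg 1%N).1. Qed.

Lemma Ck_derive (V : normedModType R) (g : R * R -> V) u :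
  (forall k, Ck k U g) -> forall k, Ck k U (pd u g).
Proof. by move=> Cg k; rewrite pdE; exact: (Cg k.+1).2. Qed.

Lemma pd_near (V : normedModType R) (g h : R * R -> V) u w :
  U w -> (forall w, U w -> g w = h w) -> pd u g w = pd u h w.
Proof.
move=> Uw gh; rewrite !pdE; apply: near_eq_derive.
exact: open_near oU Uw gh.
Qed.

Lemma pd_const (V : normedModType R) (g : R * R -> V) k u w :
  (forall w, U w -> g w = k) -> U w -> pd u g w = 0.
Proof.
move=> gk Uw; have gc w' : U w' -> g w' = cst k w' by move=> /gk ->.
by rewrite (pd_near u Uw gc) pdE derive_cst.
Qed.

Lemma pd_schwarz m k (g : R * R -> 'M[R]_(m, k)) w :
  (forall k, Ck k U g) -> U w ->
  pd (dx R) (pd (dy R) g) w = pd (dy R) (pd (dx R) g) w.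
Proof. by move=> Cg; rewrite !pdE; exact: schwarz_mx oU (Cg 2%N). Qed.

(** Almost all the scalar products of derivatives below come from
differentiating a relation <a, b> = constant. *)
Lemma derive_dot_const (a b : R * R -> 'rV[R]_4) (c : R) u w :
  (forall k, Ck k U a) -> (forall k, Ck k U b) ->
  (forall w, U w -> dot22 (a w) (b w) = c) -> U w ->
  dot22 (pd u a w) (b w) + dot22 (a w) (pd u b w) = 0.
Proof.
move=> Ca Cb ab Uw.
rewrite -(pd_bilinear _ dot22_bilinear (Ck_diff Ca Uw) (Ck_diff Cb Uw)).
exact: pd_const ab Uw.
Qed.

End OpenSet.

(** What the geometric hypotheses on an immersion and its normal say in one
chart: the parameter is conformal, the frame (f_x, f_y, f, n) is orthogonal
and positive, and the trace of the second fundamental form vanishes. *)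
Record maximal_surface (U : set (R * R)) (f n : R * R -> 'rV[R]_4) : Prop :=
  MaximalSurface {
  ms_open : open U;
  ms_smooth : forall k, Ck k U f;
  ms_pos : forall w, U w -> 0 < dot22 (pd (dx R) f w) (pd (dx R) f w);
  ms_orth : forall w, U w -> dot22 (pd (dx R) f w) (pd (dy R) f w) = 0;
  ms_eq : forall w, U w -> dot22 (pd (dy R) f w) (pd (dy R) f w) =
                           dot22 (pd (dx R) f w) (pd (dx R) f w);
  ms_AdS : forall w, U w -> dot22 (f w) (f w) = -1;
  ms_unit : forall w, U w -> dot22 (n w) (n w) = -1;
  ms_tan : forall w, U w -> dot22 (n w) (f w) = 0;
  ms_normal : forall w, U w -> forall u, dot22 (n w) (pd u f w) = 0;
  ms_det : forall w, U w ->
    0 < \det (rows4 (pd (dx R) f w) (pd (dy R) f w) (f w) (n w));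
  ms_maximal : forall w, U w ->
    dot22 (pd (dx R) (pd (dx R) f) w) (n w) +
    dot22 (pd (dy R) (pd (dy R) f) w) (n w) = 0
}.

Section Geometry.
Variables (U : set (R * R)) (f n : R * R -> 'rV[R]_4).
Hypothesis S : maximal_surface U f n.

Local Notation X := (dx R).
Local Notation Y := (dy R).
Local Notation fx := (pd (dx R) f).
Local Notation fy := (pd (dy R) f).
Local Notation nx := (pd (dx R) n).
Local Notation ny := (pd (dy R) n).
Local Notation dot := (@dot22 R).

Definition conf_factor w := dot (fx w) (fx w).
Local Notation l := conf_factor.

Let oU := ms_open S.
Let Cf := ms_smooth S.
Let l0 : forall w, U w -> 0 < l w := ms_pos S.
Let fxy0 := ms_orth S.
Let fyy : forall w, U w -> dot (fy w) (fy w) = l w := ms_eq S.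
Let ff := ms_AdS S.
Let nn := ms_unit S.
Let nf := ms_tan S.
Let nfu := ms_normal S.
Let detP := ms_det S.
Let maximal := ms_maximal S.

Definition hess_xx w := dot (pd X fx w) (n w).
Definition hess_xy w := dot (pd X fy w) (n w).
Local Notation L := hess_xx.
Local Notation M := hess_xy.

Let Cfx : forall k, Ck k U fx := Ck_derive X Cf.
Let Cfy : forall k, Ck k U fy := Ck_derive Y Cf.

Lemma dot_df_f u w : U w -> dot (pd u f w) (f w) = 0.
Proof.
move=> Uw; have := derive_dot_const oU u Cf Cf ff Uw.
by rewrite (dot22C (f w)) -mulr2n => /eqP; rewrite mulrn_eq0 => /eqP.
Qed.

Lemma mixed_partials w : U w -> pd X fy w = pd Y fx w.
Proof. exact: (pd_schwarz oU). Qed.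

(** The unit bivector of the oriented tangent plane, e_1 ^ e_2 for any
oriented orthonormal tangent frame. *)
Definition tangent_biv w := (l w)^-1 *: wedge (fx w) (fy w).
Local Notation A := tangent_biv.

Lemma Ck_conf_factor k : Ck k U l.
Proof. exact: (Ck_bilinear oU dot22_bilinear). Qed.

Let l_neq0 w : U w -> l w != 0. Proof. by move=> /l0 lw; rewrite gt_eqF. Qed.

Lemma Ck_tangent_biv k : Ck k U A.
Proof.
exact: (Ck_bilinear oU (scale_bilinear _) (CkV oU l_neq0 (Ck_conf_factor k))
  (Ck_bilinear oU wedge_bilinear (Cfx k) (Cfy k))).
Qed.

Let dot_df_n u w (Uw : U w) : dot (pd u f w) (n w) = 0 :=
  etrans (dot22C _ _) (nfu Uw u).
Let dot_f_n w (Uw : U w) : dot (f w) (n w) = 0 := etrans (dot22C _ _) (nf Uw).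

Lemma surface_frame_expand w v : U w ->
  v = (dot v (fx w) / l w) *: fx w + (dot v (fy w) / l w) *: fy w
      - dot v (f w) *: f w - dot v (n w) *: n w.
Proof.
move=> Uw.
exact: (frame_expand (l0 Uw) (erefl _) (fyy Uw) (ff Uw) (nn Uw) (fxy0 Uw)
  (dot_df_f X Uw) (dot_df_n X Uw) (dot_df_f Y Uw) (dot_df_n Y Uw) (dot_f_n Uw)
    (detP Uw)).
Qed.

(** The normal plane, with the orientation of n ^ f, is the star of the
tangent plane; this identifies the Gauss map of the surface with a linear
image of [tangent_biv]. *)
Lemma hodge_tangent_biv w : U w -> hodge (A w) = wedge (n w) (f w).
Proof.
move=> Uw.
have hE := hodge_wedge (l0 Uw) (erefl _) (fyy Uw) (ff Uw) (nn Uw) (fxy0 Uw)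
  (dot_df_f X Uw) (dot_df_n X Uw) (dot_df_f Y Uw) (dot_df_n Y Uw) (dot_f_n Uw)
    (detP Uw).
by rewrite /A hodgeZ hE scalerA mulVf ?scale1r // l_neq0.
Qed.

(** Contracting n ^ f = star A with f gives - n, and A is a smooth expression
in the first derivatives of f. *)
Lemma Ck_normal k : Ck k U n.
Proof.
(* <f, f> = -1 is the source of the sign. *)
apply: (@Ck_congr _ _ _ _ (fun w => - contraction (f w) (hodge (A w)))) => //.
  move=> w Uw; rewrite hodge_tangent_biv // contraction_wedge ff // dot22C
    nf //.
  by rewrite scale0r subr0 scaleN1r opprK.
apply: (Ck_linear (L := fun v => - v)) => //.
  by split=> [a u v|]; [rewrite opprD scalerN|exact: opp_continuous].
apply: (Ck_bilinear oU contraction_bilinear) => //.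
exact: (Ck_linear oU hodge_linear (Ck_tangent_biv k)).
Qed.

Lemma dot_dn_df u v w : U w -> dot (pd u n w) (pd v f w) =
  - dot (pd u (pd v f) w) (n w).
Proof.
move=> Uw; have := derive_dot_const oU u Ck_normal (Ck_derive v Cf) (c := 0) _
  Uw.
move=> /(_ (fun w Uw => nfu Uw v)) /eqP; rewrite addr_eq0 => /eqP ->.
by rewrite dot22C.
Qed.

Lemma dot_dn_f u w : U w -> dot (pd u n w) (f w) = 0.
Proof.
by move=> Uw; have := derive_dot_const oU u Ck_normal Cf nf Uw;
  rewrite nfu // addr0.
Qed.

Lemma dot_dn_n u w : U w -> dot (pd u n w) (n w) = 0.
Proof.
move=> Uw; have := derive_dot_const oU u Ck_normal Ck_normal nn Uw.
by rewrite (dot22C (n w)) -mulr2n => /eqP; rewrite mulrn_eq0 => /eqP.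
Qed.

(** The derivative of n is tangent to the surface, and its products with f_x
and f_y are, up to sign, coefficients of the second fundamental form. *)
Lemma weingarten_dx w : U w -> nx w = - (L w / l w) *: fx w - (M w / l w) *: fy
  w.
Proof.
move=> Uw; apply: (etrans (surface_frame_expand (nx w) Uw)).
rewrite (dot_dn_f X Uw) (dot_dn_n X Uw) !scale0r !subr0.
by rewrite (dot_dn_df X X Uw) (dot_dn_df X Y Uw) !mulNr !scaleNr.
Qed.

Lemma hess_yy w : U w -> dot (pd Y fy w) (n w) = - L w.
Proof. by move=> Uw; have /eqP := maximal Uw;
  rewrite addrC addr_eq0 => /eqP. Qed.

Lemma weingarten_dy w : U w -> ny w = - (M w / l w) *: fx w + (L w / l w) *: fy
  w.
Proof.
move=> Uw; apply: (etrans (surface_frame_expand (ny w) Uw)).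
rewrite (dot_dn_f Y Uw) (dot_dn_n Y Uw) !scale0r !subr0.
by rewrite (dot_dn_df Y X Uw) (dot_dn_df Y Y Uw) -(mixed_partials Uw)
  (hess_yy Uw) opprK mulNr.
Qed.

Lemma dot_ddf_f u v w : U w -> dot (pd u (pd v f) w) (f w) =
  - dot (pd u f w) (pd v f w).
Proof.
move=> Uw; have := derive_dot_const oU u (Ck_derive v Cf) Cf (dot_df_f v) Uw.
by move=> /eqP; rewrite addr_eq0 => /eqP ->; rewrite dot22C.
Qed.

Lemma pd_conf_factor u w : U w -> pd u l w = 2 * dot (pd u fx w) (fx w).
Proof.
move=> Uw; have dfx := Ck_diff Cfx Uw.
by rewrite (pd_bilinear u dot22_bilinear dfx dfx) (dot22C (fx w)) -mulr2n
  mulr_natl.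
Qed.

Lemma pd_conf_factor_dy u w : U w -> pd u l w = 2 * dot (pd u fy w) (fy w).
Proof.
move=> Uw; have dfy := Ck_diff Cfy Uw.
have -> : pd u l w = pd u (fun w => dot (fy w) (fy w)) w.
  by apply: (pd_near oU u Uw) => x Ux; rewrite (fyy Ux).
by rewrite (pd_bilinear u dot22_bilinear dfy dfy) (dot22C (fy w)) -mulr2n
  mulr_natl.
Qed.

Lemma pd_tangent_biv u w : U w -> pd u A w =
  (l w)^-1 *: (wedge (pd u fx w) (fy w) + wedge (fx w) (pd u fy w))
  - ((l w) ^- 2 * pd u l w) *: wedge (fx w) (fy w).
Proof.
move=> Uw; have dfx := Ck_diff Cfx Uw; have dfy := Ck_diff Cfy Uw.
have dl := Ck_diff Ck_conf_factor Uw; have lw := l_neq0 Uw.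
have dw := bilinear_differentiable_comp wedge_bilinear dfx dfy.
rewrite (pd_bilinear u (scale_bilinear _) (differentiableV dl lw) dw).
rewrite (pd_bilinear u wedge_bilinear dfx dfy).
by rewrite (pdV u dl lw) addrC scaleNr.
Qed.

(** By Gauss, f_xx has f_x-component l_x / (2 l), f-component l and
n-component - L, while f_xy has f_y-component l_x / (2 l) and n-component - M.
The terms in l_x cancel against the derivative of 1 / l, and what remains is
recognized from the expression of n_y. *)
Lemma tangent_biv_dx w : U w -> pd X A w =
  wedge (f w) (fy w) - wedge (n w) (ny w).
Proof.
move=> Uw; rewrite pd_tangent_biv // weingarten_dy //.
have lw := l_neq0 Uw.
rewrite {1}(surface_frame_expand (pd X fx w) Uw)
  {1}(surface_frame_expand (pd X fy w) Uw).
rewrite !dot_ddf_f // -/(l w) -/(L w) -/(M w).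
have -> : dot (pd X fy w) (fy w) =
  pd X l w / 2 by rewrite pd_conf_factor_dy //; field.
have -> : dot (pd X fx w) (fx w) = pd X l w / 2 by rewrite pd_conf_factor //;
  field.
rewrite fxy0 //.
apply/matrixP => i j; rewrite !(wedgeE, mxE); field.
exact: lw.
Qed.

Lemma tangent_biv_dy w : U w -> pd Y A w =
  wedge (n w) (nx w) - wedge (f w) (fx w).
Proof.
move=> Uw; rewrite pd_tangent_biv // weingarten_dx //.
have lw := l_neq0 Uw.
rewrite {1}(surface_frame_expand (pd Y fx w) Uw)
  {1}(surface_frame_expand (pd Y fy w) Uw).
rewrite !dot_ddf_f // (dot22C (fy w) (fx w)) -/(l w) -mixed_partials // -/(M w).
rewrite [in dot (pd X fy w) (fx w)]mixed_partials //.
have -> : dot (pd Y fy w) (n w) = - L w.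
  by have /eqP := maximal Uw; rewrite addrC addr_eq0 => /eqP.
have -> : dot (pd Y fy w) (fy w) =
  pd Y l w / 2 by rewrite pd_conf_factor_dy //; field.
have -> : dot (pd Y fx w) (fx w) = pd Y l w / 2 by rewrite pd_conf_factor //;
  field.
rewrite fxy0 // fyy //.
apply/matrixP => i j; rewrite !(wedgeE, mxE); field.
exact: lw.
Qed.

(** The derivatives of f ^ f_y - n ^ n_y and of n ^ n_x - f ^ f_x contain f ^
f_xy, f ^ f_yx, n ^ n_xy and n ^ n_yx, which cancel by symmetry of the second
derivatives. The remaining n_x ^ n_y is - (L^2 + M^2) / l^2 times f_x ^ f_y,
as the shape operator is traceless. *)
Lemma tangent_biv_laplacian w : U w -> pd X (pd X A) w + pd Y (pd Y A) w =
  (2 * (l w + (L w ^+ 2 + M w ^+ 2) / l w)) *: A w.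
Proof.
move=> Uw.
have Cn := Ck_normal; have Cnx := Ck_derive X Cn; have Cny := Ck_derive Y Cn.
have dfx := Ck_diff Cfx Uw; have dfy := Ck_diff Cfy Uw.
have df := Ck_diff Cf Uw; have dn := Ck_diff Cn Uw.
have dnx := Ck_diff Cnx Uw; have dny := Ck_diff Cny Uw.
have bw := wedge_bilinear.
rewrite (pd_near oU X Uw tangent_biv_dx) (pd_near oU Y Uw tangent_biv_dy).
rewrite (pdB X (bilinear_differentiable_comp bw df dfy)
  (bilinear_differentiable_comp bw dn dny)).
rewrite (pdB Y (bilinear_differentiable_comp bw dn dnx)
  (bilinear_differentiable_comp bw df dfx)).
rewrite (pd_bilinear X bw df dfy) (pd_bilinear X bw dn dny).
rewrite (pd_bilinear Y bw dn dnx) (pd_bilinear Y bw df dfx).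
rewrite (mixed_partials Uw) (pd_schwarz oU Cn Uw) (weingarten_dx Uw)
  (weingarten_dy Uw) /A.
have lw := l_neq0 Uw.
move: (fx w) (fy w) (pd Y fx w) (pd Y nx w) (n w) (f w) (L w) (M w) (l w) lw.
move=> a b c d e f' l1 m1 l2 lw.
by apply/matrixP => i j; rewrite !(wedgeE, mxE); field.
Qed.

Lemma pd_tangent_biv_frame u w : U w -> pd u A w =
  u.1 *: wedge (f w) (fy w) + (- u.2) *: wedge (f w) (fx w)
  + ((M w * u.1 - L w * u.2) / l w) *: wedge (n w) (fx w)
  + (- (L w * u.1 + M w * u.2) / l w) *: wedge (n w) (fy w).
Proof.
move=> Uw; have lw := l_neq0 Uw.
rewrite (pd_coordinates u (Ck_diff Ck_tangent_biv Uw)) (tangent_biv_dx Uw)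
  (tangent_biv_dy Uw).
rewrite (weingarten_dx Uw) (weingarten_dy Uw).
move: (fx w) (fy w) (n w) (f w) (L w) (M w) (l w) lw => a b c d l1 m1 l2 lw.
by apply/matrixP => i j; rewrite !(wedgeE, mxE); field.
Qed.

Lemma tangent_biv_metric u v w : U w -> biv_metric (pd u A w) (pd v A w) =
  (l w + (L w ^+ 2 + M w ^+ 2) / l w) * (u.1 * v.1 + u.2 * v.2).
Proof.
move=> Uw; have lw := l_neq0 Uw.
rewrite (pd_tangent_biv_frame u Uw) (pd_tangent_biv_frame v Uw).
rewrite (frame_metric (erefl _) (fyy Uw) (ff Uw) (nn Uw) (fxy0 Uw)
  (dot_df_f X Uw) (dot_df_n X Uw) (dot_df_f Y Uw) (dot_df_n Y Uw) (dot_f_n Uw))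
    -/(l w).
by field.
Qed.

(** This quadratic form has no l in it: it is four times the imaginary part of
the Hopf differential. *)
Lemma tangent_biv_wedge22 u v w : U w -> wedge22 (pd u A w) (pd v A w) =
  2 * M w * (u.1 * v.1 - u.2 * v.2) - 2 * L w * (u.1 * v.2 + u.2 * v.1).
Proof.
move=> Uw; have lw := l_neq0 Uw.
rewrite (pd_tangent_biv_frame u Uw) (pd_tangent_biv_frame v Uw).
rewrite (frame_cross (l0 Uw) (erefl _) (fyy Uw) (ff Uw) (nn Uw) (fxy0 Uw)
  (dot_df_f X Uw) (dot_df_n X Uw) (dot_df_f Y Uw) (dot_df_n Y Uw) (dot_f_n Uw)
    (detP Uw)).
by field.
Qed.

End Geometry.
End Surface.

(** * Conformal harmonic maps are minimal *)

Section Minimal.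
Context {R : realType} {V : normedModType R}.
Variables (B : V -> V -> R) (T : V -> set V).

Lemma conformal_gram (f : R * R -> V) w mu :
  (forall u v, first_ff B f w u v = mu * (u.1 * v.1 + u.2 * v.2)) ->
  (\matrix_(i, j) first_ff B f w (dxy R i) (dxy R j)) = mu%:M :> 'M[R]_2.
Proof.
move=> ffE; apply/matrixP => i j; rewrite !mxE ffE /dxy.
case: i => [[|[|//]] Hi]; case: j => [[|[|//]] Hj];
  rewrite -!val_eqE /= ?mulr1n ?mulr0n; ring.
Qed.

Lemma mean_curvature_sum (f : R * R -> V) w mu (II : 'I_2 -> 'I_2 -> V) :
  (forall u v, first_ff B f w u v = mu * (u.1 * v.1 + u.2 * v.2)) ->
  \sum_i \sum_j
    invmx (\matrix_(i, j) first_ff B f w (dxy R i) (dxy R j)) i j *: II i j =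
  mu^-1 *: (II 0 0 + II 1 1).
Proof.
move=> /conformal_gram ->; rewrite invmx_scalar !big_ord_recl !big_ord0 !mxE /=.
rewrite !addr0 !mulr1n !mulr0n !scale0r addr0 add0r scalerDr.
by congr (_ *: II _ _ + _ *: II _ _); apply: val_inj.
Qed.

(** [P] plays the role of the projection onto the tangent space of the ambient
manifold. The second fundamental form is P(D_i D_j f) minus its tangential
part, which is computed from its products with f_x and f_y. The trace is taken
with respect to a multiple of the Euclidean metric, so P(D_i D_j f)
contributes the projected Laplacian, zero by hypothesis, and the tangential
part is a combination of the products of that same projected Laplacian with
f_x and f_y. *)
Lemma conformal_harmonic_minimal (f : R * R -> V) w mu (P : V -> V)
    (fx fy : V) (H : 'I_2 -> 'I_2 -> V) :
  (forall y, linear (B^~ y)) -> (forall x, linear (B x)) -> linear P ->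
  (forall u, 'D_u f w = u.1 *: fx + u.2 *: fy) ->
  (forall i j, 'D_(dxy R i) ('D_(dxy R j) f) w = H i j) ->
  0 < mu ->
  (forall u v, first_ff B f w u v = mu * (u.1 * v.1 + u.2 * v.2)) ->
  (forall a x y, T (f w) x -> T (f w) y -> T (f w) (a *: x + y)) ->
  T (f w) fx -> T (f w) fy ->
  (forall i j, T (f w) (P (H i j))) ->
  (forall i j eta, T (f w) eta -> B (H i j - P (H i j)) eta = 0) ->
  P (H 0 0 + H 1 1) = 0 ->
  mean_curvature B T f w 0.
Proof.
move=> Bl Br Pl Df DDf mu0 ffE Tlin Tfx Tfy TP PH PH0.
have BDl x y z : B (x + y) z = B x z + B y z.
  by have := Bl z 1 x y; rewrite /= !scale1r.
have B0l z : B 0 z = 0 by have := BDl 0 0 z; rewrite addr0 => /eqP;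
  rewrite -subr_eq subrr => /eqP <-.
have BZl a x z : B (a *: x) z = a * B x z.
  by have := Bl z a x 0; rewrite /= addr0 B0l addr0.
have BNl x z : B (- x) z = - B x z by rewrite -scaleN1r BZl mulN1r.
have BDr x y z : B z (x + y) = B z x + B z y.
  by have := Br z 1 x y; rewrite /= !scale1r.
have B0r z : B z 0 = 0 by have := BDr 0 0 z; rewrite addr0 => /eqP;
  rewrite -subr_eq subrr => /eqP <-.
have BZr a x z : B z (a *: x) = a * B z x.
  by have := Br z a x 0; rewrite /= addr0 B0r addr0.
have PD x y : P (x + y) = P x + P y by have := Pl 1 x y; rewrite !scale1r.
have Bfx : B fx fx = mu.
  have := ffE (1, 0) (1, 0);
    rewrite /first_ff !Df /= scale1r scale0r addr0 => ->.
  by ring.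
have Bfy : B fy fy = mu.
  have := ffE (0, 1) (0, 1);
    rewrite /first_ff !Df /= scale1r scale0r add0r => ->.
  by ring.
have Bfxy : B fx fy = 0.
  have := ffE (1, 0) (0, 1);
    rewrite /first_ff !Df /= !scale1r !scale0r addr0 add0r => ->.
  by ring.
have Bfyx : B fy fx = 0.
  have := ffE (0, 1) (1, 0);
    rewrite /first_ff !Df /= !scale1r !scale0r addr0 add0r => ->.
  by ring.
have mun : mu != 0 by rewrite gt_eqF.
have BP i j eta : T (f w) eta -> B (P (H i j)) eta = B (H i j) eta.
  by move=> /(PH i j); rewrite BDl BNl => /eqP; rewrite subr_eq0 => /eqP ->.
(* coordinates of the tangential part of D_i D_j f *)
pose cx i j := B (H i j) fx / mu; pose cy i j := B (H i j) fy / mu.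
have T0 : T (f w) 0 by have := Tlin (-1) _ _ Tfx Tfx; rewrite scaleN1r addNr.
exists (fun i j => P (H i j) - (cx i j *: fx + cy i j *: fy)).
  move=> i j; split.
  - rewrite addrC -scaleN1r; apply: (Tlin) => //; apply: (Tlin) => //.
    by rewrite -[_ *: fy]addr0; apply: (Tlin).
  - move=> a; rewrite Df BDr !BZr !(BDl, BNl, BZl) !BP // Bfx Bfy Bfxy Bfyx.
    by rewrite /cx /cy; field.
  - exists (cx i j, cy i j) => eta Teta.
    rewrite DDf Df /= -[RHS](PH i j eta Teta); congr (B _ eta).
    by rewrite opprB addrA subrK.
rewrite (mean_curvature_sum _ ffE).
have Bs v : T (f w) v -> B (H 0 0) v + B (H 1 1) v = 0.
  by move=> Tv; rewrite -!BP // -BDl -PD PH0 B0l.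
(* Grouping by components shows that only H 0 0 + H 1 1 matters. *)
have -> : P (H 0 0) - (cx 0 0 *: fx + cy 0 0 *: fy) +
    (P (H 1 1) - (cx 1 1 *: fx + cy 1 1 *: fy)) =
  P (H 0 0 + H 1 1) - (((cx 0 0 + cx 1 1) *: fx) + (cy 0 0 + cy 1 1) *: fy).
  by rewrite PD addrACA -opprD addrACA -!scalerDl.
by rewrite PH0 /cx /cy -!mulrDl !Bs // !mul0r !scale0r addr0 subr0 !scaler0.
Qed.

End Minimal.

(** * From immersions of a Riemann surface to conformal parameters *)

Section Charts.
Context {R : realType}.

(** The complex norm of a + i b is the square root of a^2 + b^2, and positive
elements of the complex field have zero imaginary part. *)
Lemma complex_of_pair_continuous :
  continuous (fun w : R * R => (w.1 +i* w.2 : R[i]^o)).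
Proof.
move=> w; apply/cvgrPdist_lt => e e0.
have [er ei] : complex.Im e = 0 /\ 0 < complex.Re e.
  by move: e0; rewrite ltcE /= => /andP[/eqP -> ->].
have e2 : 0 < complex.Re e / 2 by rewrite divr_gt0.
have n1 : \forall x \near w, `|w.1 - x.1| < complex.Re e / 2.
  have : {for w, continuous (fst : R * R -> R)} by exact: cvg_fst.
  by move=> /cvgrPdist_lt; apply.
have n2 : \forall x \near w, `|w.2 - x.2| < complex.Re e / 2.
  have : {for w, continuous (snd : R * R -> R)} by exact: cvg_snd.
  by move=> /cvgrPdist_lt; apply.
apply: filterS2 n1 n2 => x; set a := w.1 - x.1; set b := w.2 - x.2 => ha hb.
rewrite normc_def ltcE /= er eqxx /=.
rewrite -/a -/b.
rewrite -[X in _ < X]ger0_norm ?ltW // -sqrtr_sqr ltr_sqrt ?exprn_gt0 //.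
rewrite -(real_normK (num_real a)) -(real_normK (num_real b)).
have := normr_ge0 a; have := normr_ge0 b; nra.
Qed.

Lemma open_conf_dom (S : topologicalType) (c : chart R S) : open (conf_dom c).
Proof.
have := @open_comp _ _ (fun w : R * R => (w.1 +i* w.2 : R[i]^o)) (img c).
by apply; [move=> w _; exact: complex_of_pair_continuous|exact: img_open].
Qed.

Lemma pd_dir (V : normedModType R) (g : R * R -> V) w k (u : R * R) :
  differentiable g w -> pd (k *: u) g w = k *: pd u g w.
Proof. by move=> dg; rewrite !pdE !deriveE // linearZ. Qed.

End Charts.

Section Immersion.
Context {R : realType} (S : riemannSurface R).
Variables (phi N : S -> 'rV[R]_4).
Hypotheses (hphi : conformal_maximal phi) (hN : unit_normal phi N).
Variables (c : chart R S) (hc : atlas c).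
Local Notation U := (conf_dom c).
Local Notation f := (local c phi).
Local Notation n := (local c N).

(** A vector of the ambient tangent space that is normal to the surface
detects only the second fundamental form. *)
Lemma second_ff_normal (g : R * R -> 'rV[R]_4) w u v xi eta :
  second_ff (@dot22 R) (@tan_AdS3 R) g w u v xi ->
  tan_AdS3 (g w) eta -> (forall a, dot22 eta (pd a g w) = 0) ->
  dot22 (pd u (pd v g) w) eta = dot22 xi eta.
Proof.
move=> [_ _ [a Ha]] Teta Da; have := Ha eta Teta.
have Da' : dot22 ('D_a g w) eta = 0 by rewrite dot22C -(Da a) pdE.
rewrite dot22Dl dot22Dl !dot22Nl Da' subr0 => /eqP.
by rewrite subr_eq0 => /eqP <-; rewrite !pdE.
Qed.

Lemma maximal_surface_chart : maximal_surface U f n.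
Proof.
have oU : open U := @open_conf_dom _ _ c.
have [adS [[sm im] sp co mc]] := hphi.
have ffE w : U w -> exists2 mu : R, 0 < mu & forall u v,
    dot22 (pd u f w) (pd v f w) = mu * (u.1 * v.1 + u.2 * v.2).
  move=> Uw; have [mu mu0 E] := co c hc w Uw.
  by exists mu => // u v; rewrite !pdE -E.
split => //.
- exact: sm.
- move=> w Uw; have [mu mu0 ->] := ffE w Uw.
  by rewrite /dx /= mulr1 mulr0 addr0 mulr1.
- move=> w Uw; have [mu mu0 ->] := ffE w Uw.
  by rewrite /dx /dy /=; ring.
- move=> w Uw; have [mu mu0 E] := ffE w Uw; rewrite !E.
  by rewrite /dx /dy /=; ring.
- by move=> w Uw; exact: adS.
- by move=> w Uw; have [] := hN hc Uw.
- by move=> w Uw; have [] := hN hc Uw.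
- by move=> w Uw u; rewrite pdE; have [] := hN hc Uw.
- by move=> w Uw; rewrite !pdE; have [] := hN hc Uw.
- move=> w Uw; have [n1 n2 n3 _] := hN hc Uw.
  have [II IIE H0] := mc c hc w Uw.
  have [mu mu0 E] := co c hc w Uw.
  move: H0; rewrite (mean_curvature_sum _ E) scalerA => /esym/eqP.
  rewrite scaler_eq0 mulf_eq0 !invr_eq0 pnatr_eq0 /= gt_eqF //= => /eqP II0.
  have n3' a : dot22 (n w) (pd a f w) = 0 by rewrite pdE.
  rewrite (second_ff_normal (IIE 0 0) n2 n3')
    (second_ff_normal (IIE 1 1) n2 n3').
  by rewrite -dot22Dl II0 /dot22 !mxE; ring.
Qed.

End Immersion.

(** * Second fundamental form, Gauss map and Hopf differential in a chart *)

Section InChart.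
Context {R : realType}.

(** For a conformal parameter with factor [l], the coordinate frame divided by
the square root of [l] is orthonormal. *)
Definition coord_frame (l : R) (i : 'I_2) : R * R := (Num.sqrt l)^-1 *: dxy R i.

Section OneSurface.
Variables (U : set (R * R)) (f n : R * R -> 'rV[R]_4).
Hypothesis H : maximal_surface U f n.
Local Notation l := (conf_factor f).
Local Notation L := (hess_xx f n).
Local Notation M := (hess_xy f n).

Lemma conf_factor_neq0 w : U w -> l w != 0.
Proof. by move=> Uw; rewrite gt_eqF // (ms_pos H Uw). Qed.

Lemma first_ff_conf w u v : U w ->
  first_ff (@dot22 R) f w u v = l w * (u.1 * v.1 + u.2 * v.2).
Proof.
move=> Uw; have df := Ck_diff (ms_smooth H) Uw.
rewrite /first_ff !derive_pd (pd_coordinates u df) (pd_coordinates v df).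
rewrite !(dot22Dl, dot22Zl, dot22Dr, dot22Zr)
  (dot22C (pd (dy R) f w) (pd (dx R) f w)).
rewrite (ms_orth H Uw) (ms_eq H Uw) -/(l w); ring.
Qed.

Lemma coord_frame_orthonormal w : U w ->
  orthonormal_frame (@dot22 R) f w (coord_frame (l w)).
Proof.
move=> Uw i j; rewrite first_ff_conf //.
have l0 : 0 < l w := ms_pos H Uw.
have s0 : Num.sqrt (l w) != 0 by rewrite gt_eqF // sqrtr_gt0.
rewrite /coord_frame; move: s0 (sqr_sqrtr (ltW l0)).
move: (Num.sqrt (l w)) => r s0 <-; rewrite /dxy /dx /dy.
case: i => [[|[|//]] Hi]; case: j => [[|[|//]] Hj];
  rewrite -!val_eqE /= /GRing.scale /=; field; exact: s0.
Qed.

Lemma coord_frame_oriented w : U w -> oriented (coord_frame (l w)).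
Proof.
move=> Uw; have l0 : 0 < l w := ms_pos H Uw.
rewrite /oriented /coord_frame /dxy /= /GRing.scale /=.
by rewrite mulr0 mul0r subr0 !mulr1 -invfM invr_gt0 mulr_gt0 // sqrtr_gt0.
Qed.

Lemma gauss_tangent w : U w ->
  wedge (pd (coord_frame (l w) 0) f w) (pd (coord_frame (l w) 1) f w) =
  tangent_biv f w.
Proof.
move=> Uw; have df := Ck_diff (ms_smooth H) Uw.
rewrite /coord_frame !pd_dir // /dxy /= /tangent_biv.
have l0 : 0 < l w := ms_pos H Uw.
have -> : (l w)^-1 = (Num.sqrt (l w))^-1 * (Num.sqrt (l w))^-1.
  by rewrite -invfM -expr2 sqr_sqrtr // ltW.
by apply/matrixP => i j; rewrite !(wedgeE, mxE); ring.
Qed.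

Lemma second_ff_coef w u v k : U w ->
  second_ff (@dot22 R) (@tan_AdS3 R) f w u v (k *: n w) ->
  k = - dot22 (pd u (pd v f) w) (n w).
Proof.
move=> Uw sf; rewrite (second_ff_normal sf (ms_tan H Uw) (ms_normal H Uw)).
by rewrite dot22Zl (ms_unit H Uw); ring.
Qed.

Lemma pd2_dir (V : normedModType R) (g : R * R -> V) w a u b v : U w ->
  (forall k, Ck k U g) ->
  pd (a *: u) (pd (b *: v) g) w = (a * b) *: pd u (pd v g) w.
Proof.
move=> Uw Cg; have oU := ms_open H.
have dv := Ck_diff (Ck_derive v Cg) Uw.
have dvb : differentiable (fun x => b *: pd v g x) w.
  by have := differentiableZ b dv.
rewrite (pd_near (h := fun x => b *: pd v g x) oU _ Uw); last first.
  by move=> x Ux; rewrite pd_dir //; exact: Ck_diff Cg Ux.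
rewrite pd_dir //; rewrite -scalerA; congr (_ *: _).
by rewrite !pdE; rewrite deriveZ //; apply: diff_derivable; move: dv;
  rewrite pdE.
Qed.

(** In an orthonormal coordinate frame the coefficients of the second
fundamental form are L / l, M / l, M / l and - L / l, up to a common sign. *)
Lemma sff_sum w (h : 'I_2 -> 'I_2 -> R) : U w ->
  (forall i j, second_ff (@dot22 R) (@tan_AdS3 R) f w
    (coord_frame (l w) i) (coord_frame (l w) j) (h i j *: n w)) ->
  \sum_i \sum_j h i j ^+ 2 = 2 * (L w ^+ 2 + M w ^+ 2) / l w ^+ 2.
Proof.
move=> Uw hE; have Cf := ms_smooth H.
have l0 : 0 < l w := ms_pos H Uw; have ln := conf_factor_neq0 Uw.
have E i j : h i j = - (l w)^-1 * dot22 (pd (dxy R i) (pd (dxy R j) f) w) (n w).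
  rewrite (second_ff_coef Uw (hE i j)) /coord_frame pd2_dir // dot22Zl mulNr.
  by rewrite -invfM -expr2 sqr_sqrtr // ltW.
rewrite !big_ord_recl !big_ord0 !E /dxy /= -/(L w) -(mixed_partials H Uw)
  (hess_yy H Uw) -/(M w).
by field.
Qed.

End OneSurface.

(** A polynomial identity, stated over an arbitrary commutative ring so that
the imaginary unit can be replaced by a variable. *)
Lemma dot22_combine (K : comRingType) (h i : K) (a b a' b' : 'rV[K]_4) :
  dot22 (h *: (a - i *: b)) (h *: (a' - i *: b')) =
  h * h * (dot22 a a' + i * i * dot22 b b' - i * (dot22 a b' + dot22 b a')).
Proof. by rewrite /dot22 !mxE; ring. Qed.

Lemma dot22_map (a b : 'rV[R]_4) :
  dot22 (map_mx (real_complex R) a) (map_mx (real_complex R) b) =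
  (dot22 a b)%:C.
Proof. by rewrite /dot22 !mxE !rmorphB !rmorphD !rmorphM. Qed.

Lemma dot22_wirtinger (a b a' b' : 'rV[R]_4) :
  dot22 (2^-1 *: (map_mx (real_complex R) a - 'i%C *: map_mx (real_complex R)
    b))
        (2^-1 *: (map_mx (real_complex R) a' - 'i%C *: map_mx (real_complex R)
          b'))
  = ((dot22 a a' - dot22 b b') / 4) +i* (- (dot22 a b' + dot22 b a') / 4).
Proof.
rewrite dot22_combine !dot22_map -expr2 -(expr2 'i%C) sqr_i [RHS]complexE.
move: (dot22 a a') (dot22 b b') (dot22 a b') (dot22 b a') => x y z t.
rewrite [complex.Re _]/= [complex.Im _]/=.
have -> : ((x - y) / 4)%:C = (x%:C - y%:C) / 4 by rewrite fmorph_div rmorph_nat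
  rmorphB.
have -> : (- (z + t) / 4)%:C = - (z%:C + t%:C) / 4.
  by rewrite fmorph_div rmorph_nat rmorphN rmorphD.
move: x%:C y%:C z%:C t%:C 'i%C => X Y Z T I.
by field.
Qed.

Section OneImmersion.
Context (S : riemannSurface R).
Variables (phi N : S -> 'rV[R]_4).
Hypotheses (hphi : conformal_maximal phi) (hN : unit_normal phi N).
Variables (c : chart R S) (hc : atlas c).
Local Notation U := (conf_dom c).
Local Notation f := (local c phi).
Local Notation n := (local c N).
Local Notation l := (conf_factor f).
Local Notation L := (hess_xx f n).
Local Notation M := (hess_xy f n).
Let H : maximal_surface U f n := maximal_surface_chart hphi hN hc.

Lemma sff_lengthE s w : sff_length phi N s -> U w ->
  local c s w ^+ 2 = 2 * (L w ^+ 2 + M w ^+ 2) / l w ^+ 2.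
Proof.
move=> hs Uw; have [_ He] := hs c hc w Uw.
have [h hE ->] := He _ (coord_frame_orthonormal H Uw).
exact: (sff_sum H Uw hE).
Qed.

Lemma gauss_componentE eps nu w : gauss_component eps phi N nu -> U w ->
  local c nu w = (Num.sqrt 2)^-1 *:
    (tangent_biv f w + eps *: hodge (tangent_biv f w)).
Proof.
move=> hnu Uw.
rewrite (hnu c hc w Uw _ (coord_frame_orthonormal H Uw)
  (coord_frame_oriented H Uw)).
by rewrite !derive_pd (gauss_tangent H Uw) (hodge_tangent_biv H Uw).
Qed.

(** By Weingarten, <f_x, n_x> = - L, <f_y, n_y> = L and <f_x, n_y> = <f_y,
n_x> = - M. *)
Lemma hopfE w : U w -> hopf phi N c w = (- L w / 2) +i* (M w / 2).
Proof.
move=> Uw; rewrite /hopf.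
rewrite /wirtinger dot22_wirtinger !derive_pd.
rewrite !(dot22C _ (pd _ n w)) !(dot_dn_df H) // -/(L w) -/(M w)
  -(mixed_partials H Uw) (hess_yy H Uw) -/(M w).
by congr (_ +i* _); field.
Qed.

End OneImmersion.
End InChart.

(** * One component of the Gauss map *)

Section Gauss.
Context {R : realType}.
Implicit Types (A B C : 'M[R]_4) (eps : R).

(** Twice the projection onto the eigenspace of the star operator for the
eigenvalue [eps]. *)
Definition star_part eps A : 'M[R]_4 := A + eps *: hodge A.

Lemma star_part_linear eps : continuous_linear (star_part eps).
Proof.
have l : linear (star_part eps).
  move=> a A B; rewrite /star_part (hodge_linear (R := R)).1 !scalerDr !scalerA.
  by rewrite (mulrC eps) addrACA.
by split=> //; exact: linear_mx_continuous.
Qed.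

Lemma biv_metricC A B : biv_metric A B = biv_metric B A.
Proof. by rewrite /biv_metric; ring. Qed.

Lemma biv_metric_bilinear : continuous_bilinear (@biv_metric R).
Proof.
apply: bilinear_mx_continuous => x a u v;
  first by rewrite biv_metricDl biv_metricZl.
by rewrite biv_metricDr biv_metricZr.
Qed.

(** The star operator is self-adjoint and preserves the metric, and g(A, star
B) = A ^ B. *)
Lemma biv_metric_star_part eps A B : eps ^+ 2 = 1 ->
  biv_metric (star_part eps A) (star_part eps B) =
  2 * (biv_metric A B + eps * wedge22 A B).
Proof.
move=> e1; rewrite /star_part.
rewrite !(biv_metricDl, biv_metricZl, biv_metricDr, biv_metricZr).
rewrite biv_metric_hodge2 biv_metric_hodge (biv_metricC (hodge A))
  biv_metric_hodge.
have -> : wedge22 B A = wedge22 A B by rewrite /wedge22; ring.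
have E x : eps * (eps * x) = x by rewrite mulrA -expr2 e1 mul1r.
move: (biv_metric A B) (wedge22 A B) => x y; rewrite mulrDr E; ring.
Qed.

Lemma bivector_hodge A : bivector (hodge A).
Proof.
apply/matrixP => i j; rewrite !mxE.
by elim/ord4_ind: i; elim/ord4_ind: j; rewrite /=; ring.
Qed.

Lemma bivector_lin a A B : bivector A -> bivector B -> bivector (a *: A + B).
Proof. by rewrite /bivector /= linearP /= => -> ->; rewrite scalerN opprD. Qed.

(** The relation [star_of] determines the image, as the wedge product is
nondegenerate on bivectors. *)
Lemma star_eigenE eps A : eps ^+ 2 = 1 ->
  star_eigen eps A <-> bivector A /\ hodge A = eps *: A.
Proof.
move=> e1; split=> [[bA [bE sA]]|[bA hA]].
  split=> //; apply/eqP; rewrite -subr_eq0; apply/eqP.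
  have bY : bivector (hodge A - eps *: A).
    rewrite addrC -scaleNr; apply: bivector_lin => //; exact: bivector_hodge.
  apply: bivector_eq0 => i j.
    by have /matrixP/(_ i j) := bY; rewrite !mxE.
  have bD : bivector (wedge (delta_mx 0 i) (delta_mx 0 j) : 'M[R]_4).
    by rewrite wedge_delta /bivector /= linearB /= !trmx_delta opprB.
  have -> C D : wedge22 C (D - eps *: A) = wedge22 C D - wedge22 C (eps *: A).
    by rewrite /wedge22 !mxE; ring.
  by rewrite sA // wedge22_hodge subrr.
have eA : bivector (eps *: A).
  by rewrite /bivector /= linearZ /= bA scalerN.
by split=> //; split=> // C _; rewrite -hA wedge22_hodge.
Qed.

Lemma hodgeK A : bivector A -> hodge (hodge A) = A.
Proof.
move=> /matrixP bA; apply/matrixP => i j; rewrite !mxE.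
have h k m : A k m = - A m k by have := bA m k; rewrite !mxE.
have d k : A k k = 0 by have := h k k; lra.
by elim/ord4_ind: i; elim/ord4_ind: j; rewrite /= ?d ?opprK // [RHS]h.
Qed.

Lemma star_eigen_part eps A : eps ^+ 2 = 1 -> bivector A ->
  star_eigen eps (star_part eps A).
Proof.
move=> e1 bA; apply/star_eigenE => //; split.
  rewrite /star_part addrC; apply: bivector_lin => //; exact: bivector_hodge.
rewrite /star_part addrC (hodge_linear (R := R)).1 hodgeK // scalerDr scalerA.
by rewrite -expr2 e1 scale1r addrC.
Qed.

Lemma star_eigen_lin eps a A B : eps ^+ 2 = 1 ->
  star_eigen eps A -> star_eigen eps B -> star_eigen eps (a *: A + B).
Proof.
move=> e1 /(star_eigenE _ e1)[bA hA] /(star_eigenE _ e1)[bB hB].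
apply/star_eigenE => //; split; first exact: bivector_lin.
by rewrite (hodge_linear (R := R)).1 hA hB scalerDr !scalerA mulrC.
Qed.

Lemma star_eigenZ eps a A : eps ^+ 2 = 1 ->
  star_eigen eps A -> star_eigen eps (a *: A).
Proof.
move=> e1 sA; have := star_eigen_lin (a - 1) e1 sA sA.
by rewrite scalerBl scale1r subrK.
Qed.

(** On an eigenspace the three coordinates outside e_1 ^ e_2, e_1 ^ e_3, e_1 ^
e_4 repeat these up to sign, and the metric is twice - A_01^2 + A_02^2 +
A_03^2; it is negative only if A_01 is not zero. *)
Lemma hyperboloid_neq0 eps A : eps ^+ 2 = 1 ->
  star_eigen eps A -> biv_metric A A = -1 -> A 0 1 != 0.
Proof.
move=> e1 /(star_eigenE _ e1)[bA /matrixP hA] AA; apply/eqP => A01.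
have := hA 0 1; have := hA 0 2; have := hA 0 3; rewrite !mxE /= => h1 h2 h3.
move: AA; rewrite /biv_metric A01.
have -> : A 2 3 = 0 by move: h3; rewrite A01 mulr0 => /eqP;
  rewrite oppr_eq0 => /eqP.
by nra.
Qed.

Section Factor.
Variables (U : set (R * R)) (f n : R * R -> 'rV[R]_4).
Hypothesis H : maximal_surface U f n.
Local Notation l := (conf_factor f).
Local Notation L := (hess_xx f n).
Local Notation M := (hess_xy f n).
Local Notation A := (tangent_biv f).
Variables (eps c : R).
Hypotheses (e1 : eps ^+ 2 = 1) (c1 : c ^+ 2 = 2^-1).

(** A component of the Gauss map, with the sign eps, for c = 1 / sqrt 2. The
value c = - 1 / sqrt 2 gives the opposite point, on the other sheet. *)
Definition gauss_map w : 'M[R]_4 := c *: star_part eps (A w).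
Local Notation nu := gauss_map.

Let cL : continuous_linear (fun B => c *: star_part eps B).
Proof.
have [lin _] := star_part_linear eps.
have l' : linear (fun B => c *: star_part eps B).
  by move=> a B C; rewrite lin scalerDr !scalerA mulrC.
by split=> //; exact: linear_mx_continuous.
Qed.

Let oU := ms_open H.
Let CA := Ck_tangent_biv H.

Lemma gauss_smooth k : Ck k U nu.
Proof. exact: (Ck_linear oU cL (CA k)). Qed.

Lemma pd_gauss u w : U w -> pd u nu w = c *: star_part eps (pd u A w).
Proof.
by move=> Uw; exact: (pd_linear u cL (Ck_diff CA Uw)).
Qed.

Lemma pd2_gauss u v w : U w ->
  pd u (pd v nu) w = c *: star_part eps (pd u (pd v A) w).
Proof.
move=> Uw; rewrite (pd_near oU u Uw (fun x Ux => pd_gauss v Ux)).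
exact: (pd_linear u cL (Ck_diff (Ck_derive v CA) Uw)).
Qed.

Lemma bivector_pd g u w : (forall k, Ck k U g) ->
  (forall w, U w -> bivector (g w)) -> U w -> bivector (pd u g w).
Proof.
move=> Cg bg Uw.
have cS : continuous_linear (fun B : 'M[R]_4 => B^T + B).
  have lS : linear (fun B : 'M[R]_4 => B^T + B).
    by move=> a B C; rewrite linearP /= scalerDr addrACA.
  by split=> //; exact: linear_mx_continuous.
have h x : U x -> (g x)^T + g x = 0 by move=> Ux; rewrite bg // addNr.
have E : (pd u g w)^T + pd u g w = 0.
  apply: etrans (esym (pd_linear u cS (Ck_diff Cg Uw))) _.
  exact: (pd_const oU u h Uw).
by rewrite /bivector /=; apply/eqP; rewrite -addr_eq0 E.
Qed.

Lemma bivector_tangent_biv w : bivector (A w).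
Proof.
by apply/matrixP => i j; rewrite /tangent_biv !mxE !big_ord1 !mxE; ring.
Qed.

Lemma star_gauss w : star_eigen eps (nu w).
Proof. by apply/star_eigenZ/star_eigen_part/bivector_tangent_biv. Qed.

Lemma star_pd_gauss u w : U w -> star_eigen eps (pd u nu w).
Proof.
move=> Uw; rewrite pd_gauss //; apply/star_eigenZ/star_eigen_part => //.
by apply: bivector_pd => // x _; exact: bivector_tangent_biv.
Qed.

Lemma star_pd2_gauss u v w : U w -> star_eigen eps (pd u (pd v nu) w).
Proof.
move=> Uw; rewrite pd2_gauss //; apply/star_eigenZ/star_eigen_part => //.
apply: bivector_pd => // [k|x Ux]; first exact: (Ck_derive v CA).
by apply: bivector_pd => // y _; exact: bivector_tangent_biv.
Qed.

Let metric_part B C :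
  biv_metric (c *: star_part eps B) (c *: star_part eps C) =
  biv_metric B C + eps * wedge22 B C.
Proof.
rewrite biv_metricZl biv_metricZr biv_metric_star_part // mulrA -expr2 c1.
by rewrite mulrA mulVf ?mul1r // pnatr_eq0.
Qed.

Lemma gauss_unit w : U w -> biv_metric (nu w) (nu w) = -1.
Proof.
move=> Uw; rewrite /nu metric_part.
have -> : wedge22 (A w) (A w) = 0.
  by rewrite /tangent_biv /wedge22 !mxE !big_ord1 !mxE; ring.
rewrite mulr0 addr0 /tangent_biv biv_metricZl biv_metricZr biv_metric_wedge.
rewrite (ms_orth H Uw) (dot22C _ (pd (dx R) f w)) (ms_orth H Uw) (ms_eq H Uw).
rewrite -/(l w); field; exact: (conf_factor_neq0 H Uw).
Qed.

(** Derivative of [gauss_unit]. *)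
Lemma gauss_normal u w : U w -> biv_metric (pd u nu w) (nu w) = 0.
Proof.
move=> Uw; have dn := Ck_diff gauss_smooth Uw.
have : pd u (fun w => biv_metric (nu w) (nu w)) w = 0.
  exact: (pd_const oU u gauss_unit Uw).
rewrite (pd_bilinear u biv_metric_bilinear dn dn) (biv_metricC (nu w)) -mulr2n.
by move=> /eqP; rewrite mulrn_eq0 => /eqP.
Qed.

Lemma gauss_metric u v w : U w -> biv_metric (pd u nu w) (pd v nu w) =
  (l w + (L w ^+ 2 + M w ^+ 2) / l w) * (u.1 * v.1 + u.2 * v.2) +
  eps * (2 * M w * (u.1 * v.1 - u.2 * v.2)
         - 2 * L w * (u.1 * v.2 + u.2 * v.1)).
Proof.
move=> Uw; rewrite !pd_gauss // metric_part (tangent_biv_metric H) //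
  (tangent_biv_wedge22 H) //.
Qed.

(** Being proportional to the position vector, the Laplacian is normal to the
hyperboloid: the map is harmonic. *)
Lemma gauss_laplacian w : U w ->
  pd (dx R) (pd (dx R) nu) w + pd (dy R) (pd (dy R) nu) w =
  (2 * (l w + (L w ^+ 2 + M w ^+ 2) / l w)) *: nu w.
Proof.
move=> Uw; rewrite !pd2_gauss // -scalerDr /nu.
have [lin _] := star_part_linear eps.
have -> B C : star_part eps B + star_part eps C = star_part eps (B + C).
  by have := lin 1 B C; rewrite !scale1r.
have s0 : star_part eps 0 = 0.
  by have := lin (-1) 0 0; rewrite scaleN1r oppr0 addr0 scaleN1r addNr.
have sZ k B : star_part eps (k *: B) = k *: star_part eps B.
  by have := lin k B 0; rewrite s0 !addr0.
by rewrite (tangent_biv_laplacian H Uw) sZ !scalerA mulrC.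
Qed.

End Factor.
End Gauss.

(** * The product of two components *)

Section Product.
Context {R : realType}.

Lemma pd_pair (V W : normedModType R) (f : R * R -> V) (g : R * R -> W) w u :
  differentiable f w -> differentiable g w ->
  pd u (fun x => (f x, g x)) w = (pd u f w, pd u g w).
Proof. by rewrite !pdE; exact: derive_pair. Qed.

(** The orthogonal projection onto the tangent space of the product of two
hyperboloids at [q]; the sign comes from g(q_i, q_i) = -1. *)
Definition proj_tangent (q : 'M[R]_4 * 'M[R]_4) (X : 'M[R]_4 * 'M[R]_4) :=
  (X.1 + biv_metric X.1 q.1 *: q.1, X.2 + biv_metric X.2 q.2 *: q.2).

Lemma prod_metric_linearl (Y : 'M[R]_4 * 'M[R]_4) : linear
  (@prod_metric R ^~ Y).
Proof.
move=> a X X'; rewrite /prod_metric /= !biv_metricDl !biv_metricZl.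
by rewrite /GRing.scale /=; ring.
Qed.

Lemma prod_metricC (X Y : 'M[R]_4 * 'M[R]_4) : prod_metric X Y =
  prod_metric Y X.
Proof. by rewrite /prod_metric !(biv_metricC Y.1) !(biv_metricC Y.2). Qed.

Lemma prod_metric_linearr (X : 'M[R]_4 * 'M[R]_4) : linear (@prod_metric R X).
Proof.
by move=> a Y Y'; rewrite !(prod_metricC X) (prod_metric_linearl X a Y Y').
Qed.

Lemma proj_tangent_linear q : linear (proj_tangent q).
Proof.
move=> a X Y; rewrite /proj_tangent /= !biv_metricDl !biv_metricZl.
congr (_, _) => /=; rewrite scalerDl scalerDr scalerA -!addrA; congr (_ + _);
  by rewrite addrCA.
Qed.

Section TangentProjection.
Variable q : 'M[R]_4 * 'M[R]_4.
Hypothesis hq : [/\ star_eigen 1 q.1, star_eigen (-1) q.2,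
  biv_metric q.1 q.1 = -1 & biv_metric q.2 q.2 = -1].
Let e1 : (1 : R) ^+ 2 = 1. Proof. by rewrite expr1n. Qed.
Let e2 : (-1 : R) ^+ 2 = 1. Proof. by rewrite sqrrN expr1n. Qed.

Lemma tan_hyp_plane_lin (eps a : R) (p X Y : 'M[R]_4) : eps ^+ 2 = 1 ->
  tan_hyp_plane eps p X -> tan_hyp_plane eps p Y ->
  tan_hyp_plane eps p (a *: X + Y).
Proof.
move=> e [sX X0] [sY Y0]; split; first exact: star_eigen_lin.
by rewrite biv_metricDl biv_metricZl X0 Y0 mulr0 addr0.
Qed.

Lemma tan_hyp_plane_proj (eps : R) (p X : 'M[R]_4) : eps ^+ 2 = 1 ->
  star_eigen eps p -> biv_metric p p = -1 -> star_eigen eps X ->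
  tan_hyp_plane eps p (X + biv_metric X p *: p).
Proof.
move=> e sp pp sX; split; first by rewrite addrC; exact: star_eigen_lin.
by rewrite biv_metricDl biv_metricZl pp mulrN1 subrr.
Qed.

Lemma tan_hyp_prod_lin a X Y :
  tan_hyp_prod q X -> tan_hyp_prod q Y -> tan_hyp_prod q (a *: X + Y).
Proof.
by move=> [X1 X2] [Y1 Y2]; split; apply: tan_hyp_plane_lin.
Qed.

Lemma tan_hyp_prod_proj X : star_eigen 1 X.1 -> star_eigen (-1) X.2 ->
  tan_hyp_prod q (proj_tangent q X).
Proof.
by case: hq => q1 q2 u1 u2 X1 X2; split; apply: tan_hyp_plane_proj.
Qed.

Lemma proj_tangent_orth X eta : tan_hyp_prod q eta ->
  prod_metric (X - proj_tangent q X) eta = 0.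
Proof.
have N (p Z Y : 'M[R]_4) : biv_metric Y p = 0 ->
    biv_metric (Z - (Z + biv_metric Z p *: p)) Y = 0.
  move=> Y0; rewrite opprD addrA subrr add0r -scaleNr biv_metricZl.
  by rewrite (biv_metricC p) Y0 mulr0.
by move=> [[_ t1] [_ t2]]; rewrite /prod_metric /proj_tangent /= !N // addr0.
Qed.

Lemma proj_tangent_normal X k1 k2 :
  X.1 = k1 *: q.1 -> X.2 = k2 *: q.2 -> proj_tangent q X = 0.
Proof.
case: hq => _ _ u1 u2 X1 X2.
rewrite /proj_tangent X1 X2 !biv_metricZl u1 u2 !mulrN1 !scaleNr !subrr //.
Qed.

End TangentProjection.

Variables (U : set (R * R)) (f1 n1 f2 n2 : R * R -> 'rV[R]_4).
Hypotheses (H1 : maximal_surface U f1 n1) (H2 : maximal_surface U f2 n2).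
Hypothesis hopfL : forall w, U w -> hess_xx f1 n1 w = hess_xx f2 n2 w.
Hypothesis hopfM : forall w, U w -> hess_xy f1 n1 w = hess_xy f2 n2 w.
Variables (c1 c2 : R).
Hypotheses (hc1 : c1 ^+ 2 = 2^-1) (hc2 : c2 ^+ 2 = 2^-1).
Let g1 := gauss_map f1 1 c1.
Let g2 := gauss_map f2 (-1) c2.
Variable F : R * R -> 'M[R]_4 * 'M[R]_4.
Hypothesis FE : forall w, U w -> F w = (g1 w, g2 w).
Let oU := ms_open H1.
Let e1 : (1 : R) ^+ 2 = 1. Proof. by rewrite expr1n. Qed.
Let e2 : (-1 : R) ^+ 2 = 1. Proof. by rewrite sqrrN expr1n. Qed.
Let s1 k : Ck k U g1 := gauss_smooth H1 1 c1 k.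
Let s2 k : Ck k U g2 := gauss_smooth H2 (-1) c2 k.

(** With |sigma|^2 = 2 (L^2 + M^2) / l^2, this is (2 + |sigma|^2) l / 2. *)
Definition energy f n (w : R * R) : R :=
  conf_factor f w + (hess_xx f n w ^+ 2 + hess_xy f n w ^+ 2) / conf_factor f w.

Lemma prod_smooth k : Ck k U F.
Proof.
apply: (@Ck_congr _ _ _ _ (fun w => (g1 w, g2 w))) => //.
  by move=> w Uw; rewrite FE.
exact: (Ck_pair oU (s1 k) (s2 k)).
Qed.

Lemma pd_prod u w : U w -> pd u F w = (pd u g1 w, pd u g2 w).
Proof.
move=> Uw; apply: (etrans (pd_near oU u Uw FE)).
exact: (pd_pair u (Ck_diff s1 Uw) (Ck_diff s2 Uw)).
Qed.

Lemma pd2_prod u v w : U w ->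
  pd u (pd v F) w = (pd u (pd v g1) w, pd u (pd v g2) w).
Proof.
move=> Uw; apply: (etrans (pd_near oU u Uw (fun x Ux => pd_prod v Ux))).
exact: (pd_pair u (Ck_diff (Ck_derive v s1) Uw) (Ck_diff (Ck_derive v s2) Uw)).
Qed.

(** The eps-terms of [gauss_metric] have opposite signs and, the Hopf
differentials being equal, the same coefficients: they cancel. *)
Lemma prod_first_ff w u v : U w ->
  first_ff (@prod_metric R) F w u v =
  (energy f1 n1 w + energy f2 n2 w) * (u.1 * v.1 + u.2 * v.2).
Proof.
move=> Uw; rewrite /first_ff !derive_pd !(pd_prod _ Uw) /prod_metric /=.
rewrite (gauss_metric H1 e1 hc1 u v Uw) (gauss_metric H2 e2 hc2 u v Uw).
rewrite (hopfL Uw) (hopfM Uw) /energy.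
by rewrite (hopfL Uw) (hopfM Uw); ring.
Qed.

Lemma energy_gt0 f n w : maximal_surface U f n -> U w -> 0 < energy f n w.
Proof.
move=> H Uw; have l0 : 0 < conf_factor f w := ms_pos H Uw.
apply: ltr_wpDr => //; apply: divr_ge0; last exact: ltW.
by apply: addr_ge0; exact: sqr_ge0.
Qed.

(** The Laplacian of each component is proportional to that component
([gauss_laplacian]), so its projection to the tangent space is zero and
[conformal_harmonic_minimal] applies. *)
Lemma prod_minimal w : U w ->
  mean_curvature (@prod_metric R) (@tan_hyp_prod R) F w 0.
Proof.
move=> Uw.
have F1 : (F w).1 = g1 w by rewrite FE.
have F2 : (F w).2 = g2 w by rewrite FE.
have DF1 u : (pd u F w).1 = pd u g1 w by rewrite pd_prod.
have DF2 u : (pd u F w).2 = pd u g2 w by rewrite pd_prod.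
have DDF1 u v : (pd u (pd v F) w).1 = pd u (pd v g1) w by rewrite pd2_prod.
have DDF2 u v : (pd u (pd v F) w).2 = pd u (pd v g2) w by rewrite pd2_prod.
have hq : [/\ star_eigen 1 (F w).1, star_eigen (-1) (F w).2,
    biv_metric (F w).1 (F w).1 = -1 & biv_metric (F w).2 (F w).2 = -1].
  rewrite F1 F2; split.
  - exact: (star_gauss f1 c1 e1 w).
  - exact: (star_gauss f2 c2 e2 w).
  - exact: (gauss_unit H1 e1 hc1 Uw).
  - exact: (gauss_unit H2 e2 hc2 Uw).
have Tu u : tan_hyp_prod (F w) (pd u F w).
  split; rewrite ?F1 ?F2 ?DF1 ?DF2; split.
  - exact: (star_pd_gauss H1 c1 e1 u Uw).
  - exact: (gauss_normal H1 e1 hc1 u Uw).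
  - exact: (star_pd_gauss H2 c2 e2 u Uw).
  - exact: (gauss_normal H2 e2 hc2 u Uw).
have E0 : 0 < energy f1 n1 w + energy f2 n2 w.
  by apply: addr_gt0; [exact: energy_gt0 H1 Uw|exact: energy_gt0 H2 Uw].
have TP u v : tan_hyp_prod (F w) (proj_tangent (F w) (pd u (pd v F) w)).
  apply: (tan_hyp_prod_proj hq); rewrite ?DDF1 ?DDF2.
    exact: (star_pd2_gauss H1 c1 e1 u v Uw).
  exact: (star_pd2_gauss H2 c2 e2 u v Uw).
have lap : proj_tangent (F w)
    (pd (dx R) (pd (dx R) F) w + pd (dy R) (pd (dy R) F) w) = 0.
  apply: (@proj_tangent_normal _ hq _
    (2 * energy f1 n1 w) (2 * energy f2 n2 w)).
    by rewrite /= !DDF1 F1; exact: (gauss_laplacian H1 1 c1 Uw).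
  by rewrite /= !DDF2 F2; exact: (gauss_laplacian H2 (-1) c2 Uw).
have DDE i j : 'D_(dxy R i) ('D_(dxy R j) F) w =
    pd (dxy R i) (pd (dxy R j) F) w by rewrite !pdE.
have DE u : 'D_u F w = u.1 *: pd (dx R) F w + u.2 *: pd (dy R) F w.
  by rewrite derive_pd (pd_coordinates u (Ck_diff prod_smooth Uw)).
exact: (conformal_harmonic_minimal prod_metric_linearl prod_metric_linearr
  (proj_tangent_linear (F w)) DE DDE E0 (fun u v => prod_first_ff u v Uw)
  (fun a x y => @tan_hyp_prod_lin _ a x y) (Tu _) (Tu _) (fun i j => TP _ _)
  (fun i j eta => @proj_tangent_orth _ _ eta) lap).
Qed.

End Product.

Section Sheet.
Context {R : realType}.

Lemma to_sheet_eq (A B : 'M[R]_4) :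
  A = B \/ A = - B -> 0 < B 0 1 -> to_sheet A = B.
Proof.
move=> [->|->] B0; rewrite /to_sheet ?B0 // mxE oppr_gt0.
by rewrite ltNge (ltW B0) /= opprK.
Qed.

Lemma maximal_surface_sub (U Q : set (R * R)) (f n : R * R -> 'rV[R]_4) :
  maximal_surface U f n -> open Q -> Q `<=` U -> maximal_surface Q f n.
Proof.
move=> [? C ? ? ? ? ? ? ? ? ?] oQ sQ; split; auto.
by move=> k; exact: Ck_sub sQ (C k).
Qed.

(** The coordinate (0, 1) of the Gauss map is continuous and does not vanish
on the hyperboloid, so its sign, and with it the choice of sheet, is constant
near every point. *)
Lemma gauss_map_sheet (U : set (R * R)) (f n : R * R -> 'rV[R]_4) (eps r : R) w
  :
  maximal_surface U f n -> eps ^+ 2 = 1 -> r ^+ 2 = 2^-1 -> U w ->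
  exists c Q, [/\ open Q, Q w, Q `<=` U, c ^+ 2 = 2^-1 & forall x, Q x ->
     to_sheet (gauss_map f eps r x) = gauss_map f eps c x].
Proof.
move=> H e r2 Uw.
(* the sign that puts the value at w on the chosen sheet *)
pose c := if 0 < gauss_map f eps r w 0 1 then r else - r.
have cr : c = r \/ c = - r by rewrite /c; case: ifP; [left|right].
have c2 : c ^+ 2 = 2^-1 by case: cr => ->; rewrite ?sqrrN.
have gc x : gauss_map f eps r x = gauss_map f eps c x \/
            gauss_map f eps r x = - gauss_map f eps c x.
  by case: cr => ->; [left|right; rewrite /gauss_map scaleNr opprK].
pose g x := gauss_map f eps c x 0 1.
have g0 : 0 < g w.
  have := hyperboloid_neq0 e (star_gauss f c e w) (gauss_unit H e c2 Uw).
  rewrite -/(g w) => gn; rewrite lt_def gn /= /g /c.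
  case: ifP => [/ltW //|/negbT];
    rewrite -leNgt /gauss_map scaleNr [in X in _ -> X]mxE.
  by rewrite oppr_ge0.
exists c, (U `&` [set x | 0 < g x]); split => //.
- rewrite openE => x [Ux gx].
  have cg : {for x, continuous g}.
    have cij : continuous_linear (fun M : 'M[R]_4 => M 0 1 : R).
      split=> [a M N|]; first by rewrite !mxE.
      exact: (@matrix_normedtype.coord_continuous R).
    have Cg : Ck 0 U g := Ck_linear (ms_open H) cij (gauss_smooth H eps c 0).
    exact: (Cg x Ux).
  apply: filterI; first exact: (open_nbhs_nbhs (conj (ms_open H) Ux)).
  exact: (cg [set y | 0 < y] (open_nbhs_nbhs (conj (@open_gt R 0) gx))).
- by move=> x [Ux gx]; apply: to_sheet_eq.
Qed.

End Sheet.

(** * The theorem *)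

Section Assembly.
Context {R : realType} (S : riemannSurface R).
Variables (phi psi Nphi Npsi : S -> 'rV[R]_4) (nup num : S -> 'M[R]_4).
Hypotheses (hphi : conformal_maximal phi) (hpsi : conformal_maximal psi)
  (hNphi : unit_normal phi Nphi) (hNpsi : unit_normal psi Npsi)
  (hHopf : same_hopf phi Nphi psi Npsi)
  (hnup : gauss_component 1 phi Nphi nup)
  (hnum : gauss_component (-1) psi Npsi num).
Let nu := nu_map nup num.
Let r : R := (Num.sqrt 2)^-1.
Let r2 : r ^+ 2 = 2^-1.
Proof. by rewrite /r exprVn sqr_sqrtr. Qed.
Let e1 : (1 : R) ^+ 2 = 1. Proof. by rewrite expr1n. Qed.
Let e2 : (-1 : R) ^+ 2 = 1. Proof. by rewrite sqrrN expr1n. Qed.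

Section Chart.
Variables (c : chart R S) (hc : atlas c).
Local Notation U := (conf_dom c).
Let H1 : maximal_surface U (local c phi) (local c Nphi) :=
  maximal_surface_chart hphi hNphi hc.
Let H2 : maximal_surface U (local c psi) (local c Npsi) :=
  maximal_surface_chart hpsi hNpsi hc.

Lemma same_hessian w : U w ->
  hess_xx (local c phi) (local c Nphi) w =
    hess_xx (local c psi) (local c Npsi) w /\
  hess_xy (local c phi) (local c Nphi) w =
    hess_xy (local c psi) (local c Npsi) w.
Proof.
move=> Uw; have := hHopf hc Uw.
rewrite (hopfE hphi hNphi hc Uw) (hopfE hpsi hNpsi hc Uw) => -[hL hM].
have n2 : (2 : R) != 0 by rewrite pnatr_eq0.
split; last by move/(mulIf (invr_neq0 n2)): hM.
by move/(mulIf (invr_neq0 n2)): hL => /oppr_inj.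
Qed.

(** Both choices of sheet are constant near a given point, so every local
statement reduces to a pair of maps [gauss_map]. *)
Lemma nu_local w : U w -> exists c1 c2 Q,
  [/\ open Q, Q w, Q `<=` U, c1 ^+ 2 = 2^-1 /\ c2 ^+ 2 = 2^-1 &
      forall x, Q x -> local c nu x =
        (gauss_map (local c phi) 1 c1 x, gauss_map (local c psi) (-1) c2 x)].
Proof.
move=> Uw.
have [c1 [Q1 [q1 w1 s1 h1 E1]]] := gauss_map_sheet H1 e1 r2 Uw.
have [c2 [Q2 [q2 w2 s2 h2 E2]]] := gauss_map_sheet H2 e2 r2 Uw.
exists c1, c2, (Q1 `&` Q2); split => //.
- exact: openI.
- by move=> x [/s1].
- move=> x [x1 x2]; rewrite -E1 // -E2 // /gauss_map.
  have Ux : U x by exact: s1.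
  rewrite /star_part -(gauss_componentE hphi hNphi hc hnup Ux).
  by rewrite -(gauss_componentE hpsi hNpsi hc hnum Ux).
Qed.

Lemma nu_first_ff w u v : U w ->
  first_ff (@prod_metric R) (local c nu) w u v =
  (energy (local c phi) (local c Nphi) w + energy (local c psi) (local c Npsi)
    w)
  * (u.1 * v.1 + u.2 * v.2).
Proof.
move=> Uw; have [c1 [c2 [Q [Qo Qw sQ [h1 h2] E]]]] := nu_local Uw.
exact: (prod_first_ff (maximal_surface_sub H1 Qo sQ)
  (maximal_surface_sub H2 Qo sQ)
  (fun x Qx => (same_hessian (sQ x Qx)).1)
    (fun x Qx => (same_hessian (sQ x Qx)).2)
  h1 h2 E u v Qw).
Qed.

Lemma nu_minimal w : U w ->
  mean_curvature (@prod_metric R) (@tan_hyp_prod R) (local c nu) w 0.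
Proof.
move=> Uw; have [c1 [c2 [Q [Qo Qw sQ [h1 h2] E]]]] := nu_local Uw.
exact: (prod_minimal (maximal_surface_sub H1 Qo sQ)
  (maximal_surface_sub H2 Qo sQ)
  (fun x Qx => (same_hessian (sQ x Qx)).1)
    (fun x Qx => (same_hessian (sQ x Qx)).2)
  h1 h2 E Qw).
Qed.

Lemma nu_smooth k : Ck k U (local c nu).
Proof.
apply: Ck_local => w Uw; have [c1 [c2 [Q [Qo Qw sQ [h1 h2] E]]]] := nu_local Uw.
exists Q => //.
exact: (prod_smooth (maximal_surface_sub H1 Qo sQ)
  (maximal_surface_sub H2 Qo sQ) E k).
Qed.

Lemma nu_energy_gt0 w : U w ->
  0 < energy (local c phi) (local c Nphi) w + energy (local c psi)
    (local c Npsi) w.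
Proof.
by move=> Uw; apply: addr_gt0;
  [exact: (energy_gt0 H1 Uw)|exact: (energy_gt0 H2 Uw)].
Qed.

Lemma to_sheet_hyp_plane (eps : R) (A : 'M[R]_4) : eps ^+ 2 = 1 ->
  star_eigen eps A -> biv_metric A A = -1 -> hyp_plane eps (to_sheet A).
Proof.
move=> e sA AA; have := hyperboloid_neq0 e sA AA.
move=> A0; rewrite /to_sheet; case: ifP => [|/negbT]; first by split.
rewrite -leNgt le_eqVlt (negbTE A0) /= => An; split.
- by rewrite -scaleN1r; exact: star_eigenZ.
- by rewrite -scaleN1r biv_metricZl biv_metricZr AA; ring.
- by rewrite mxE oppr_gt0.
Qed.

Lemma nu_hyp w : U w -> hyp_prod (local c nu w).
Proof.
move=> Uw; split; apply: to_sheet_hyp_plane => //.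
- have -> : nup (param c (w.1 +i* w.2)) = gauss_map (local c phi) 1 r w.
    exact: (gauss_componentE hphi hNphi hc hnup Uw).
  exact: (star_gauss _ _ e1).
- have -> : nup (param c (w.1 +i* w.2)) = gauss_map (local c phi) 1 r w.
    exact: (gauss_componentE hphi hNphi hc hnup Uw).
  exact: (gauss_unit H1 e1 r2 Uw).
- have -> : num (param c (w.1 +i* w.2)) = gauss_map (local c psi) (-1) r w.
    exact: (gauss_componentE hpsi hNpsi hc hnum Uw).
  exact: (star_gauss _ _ e2).
- have -> : num (param c (w.1 +i* w.2)) = gauss_map (local c psi) (-1) r w.
    exact: (gauss_componentE hpsi hNpsi hc hnum Uw).
  exact: (gauss_unit H2 e2 r2 Uw).
Qed.

End Chart.

Lemma nu_conformal_minimal : conformal_minimal_HH nu.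
Proof.
split.
  move=> p; have [c hc cp] := atlas_cover p.
  (* the real coordinates of p in the chart *)
pose w := (complex.Re (Defs.coord c p), complex.Im (Defs.coord c p)).
  have wE : w.1 +i* w.2 = Defs.coord c p by rewrite /w /=;
    case: (Defs.coord c p).
  have Uw : conf_dom c w by rewrite /conf_dom /= wE; exact: Defs.coord_img.
  have := nu_hyp hc Uw; rewrite /local wE Defs.coordK //.
split.
- split=> [c hc k|c hc w Uw u u0]; first exact: nu_smooth.
  apply: contra_neq u0 => Du0.
  have := nu_first_ff hc u u Uw; rewrite /first_ff Du0.
  have -> : prod_metric 0 0 = 0 :> R.
    by rewrite /prod_metric /biv_metric /= !mxE; ring.
  move=> /esym/eqP; rewrite mulf_eq0 gt_eqF ?nu_energy_gt0 //= -!expr2.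
  rewrite paddr_eq0 ?sqr_ge0 // !sqrf_eq0.
  by case: u {Du0} => a b /= /andP[/eqP -> /eqP ->].
- move=> c hc w Uw.
  exists (energy (local c phi) (local c Nphi) w + energy (local c psi)
    (local c Npsi) w).
    exact: nu_energy_gt0.
  by move=> u v; exact: nu_first_ff.
- by move=> c hc w Uw; exact: nu_minimal.
Qed.

Lemma nu_induced_metric (sphi spsi : S -> R) :
  sff_length phi Nphi sphi -> sff_length psi Npsi spsi ->
  forall c : chart R S, atlas c -> forall w, conf_dom c w ->
    forall u v : R * R,
      first_ff (@prod_metric R) (local c nu) w u v =
      2^-1 *
      ((2 + local c sphi w ^+ 2) * first_ff (@dot22 R) (local c phi) w u v
       + (2 + local c spsi w ^+ 2) * first_ff (@dot22 R) (local c psi) w u v).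
Proof.
move=> h1 h2 c hc w Uw u v.
have S1 := maximal_surface_chart hphi hNphi hc;
  have S2 := maximal_surface_chart hpsi hNpsi hc.
rewrite (nu_first_ff hc u v Uw) (first_ff_conf S1 u v Uw)
  (first_ff_conf S2 u v Uw).
rewrite (sff_lengthE hphi hNphi hc h1 Uw) (sff_lengthE hpsi hNpsi hc h2 Uw)
  /energy.
have l1 := conf_factor_neq0 S1 Uw; have l2 := conf_factor_neq0 S2 Uw.
move: l1 l2; move: (conf_factor _ w) (conf_factor _ w) (hess_xx _ _ w)
  (hess_xx _ _ w)
  (hess_xy _ _ w) (hess_xy _ _ w) => l1 l2 L1 L2 M1 M2 l10 l20.
by field; rewrite ?l10 ?l20.
Qed.

End Assembly.

Theorem theorem1 (R : realType) (S : riemannSurface R)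
  (phi psi Nphi Npsi : S -> 'rV[R]_4) (sigma_phi sigma_psi : S -> R)
  (nup_phi num_psi : S -> 'M[R]_4)
  (hphi : conformal_maximal phi) (hpsi : conformal_maximal psi)
  (hNphi : unit_normal phi Nphi) (hNpsi : unit_normal psi Npsi)
  (hHopf : same_hopf phi Nphi psi Npsi)
  (hsphi : sff_length phi Nphi sigma_phi)
  (hspsi : sff_length psi Npsi sigma_psi)
  (hnup : gauss_component 1 phi Nphi nup_phi)
  (hnum : gauss_component (-1) psi Npsi num_psi) :
  conformal_minimal_HH (nu_map nup_phi num_psi) /\
  (forall c : chart R S, atlas c -> forall w, conf_dom c w ->
    forall u v : R * R,
      first_ff (@prod_metric R) (local c (nu_map nup_phi num_psi)) w u v =
      2^-1 *
      ((2 + local c sigma_phi w ^+ 2) * first_ff (@dot22 R) (local c phi) w u v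
       + (2 + local c sigma_psi w ^+ 2)
         * first_ff (@dot22 R) (local c psi) w u v)).
Proof.
split.
  exact: (nu_conformal_minimal hphi hpsi hNphi hNpsi hHopf hnup hnum).
exact: (nu_induced_metric hphi hpsi hNphi hNpsi hHopf hnup hnum hsphi hspsi).
Qed.
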